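(* Let $k \geq 0$ be an integer, let $n = 13+9k$, and define three involutions in the symmetric group $S_n$ by $$\rho_1 = (1,2)\prod_{i=0}^{k}(8+9i,11+9i)\prod_{i=0}^{k}(3+9i,6+9i)\prod_{i=0}^{k}(7+9i,10+9i),$$ $$\rho_2 = (1,3)\prod_{i=0}^{k}(5+9i,8+9i)\prod_{i=0}^{k}(9+9i,12+9i)\prod_{i=0}^{k}(4+9i,7+9i),$$ $$\rho_3 = (1,4)\prod_{i=0}^{k}(2+9i,5+9i)\prod_{i=0}^{k}(6+9i,9+9i)\prod_{i=0}^{k}(10+9i,13+9i).$$ Let $G = \langle \rho_1,\rho_2,\rho_3\rangle$, $G_1 = \langle \rho_2,\rho_3\rangle$, $G_2 = \langle \rho_1,\rho_3\rangle$, $G_3 = \langle \rho_1,\rho_2\rangle$, and let $\Gamma = \Gamma(G,\{G_1,G_2,G_3\})$ be the associated coset geometry. Then: (a) $\Gamma$ is a thin, flag transitive and residually connected geometry; (b) $\mathrm{Aut}(\Gamma) \cong A_n$ (the alternating group) if $k$ is even, $\mathrm{Aut}(\Gamma)\cong S_n$ if $k$ is odd, and the induced action on $\Gamma$ is faithful; (c) $\Gamma$ admits trialities but no dualities; (d) the sizes $|G_1|,|G_2|,|G_3|$ of the maximal parabolics are constant, i.e. do not depend on $k$ (equivalently on $n$).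
   Context: An incidence system over a finite nonempty type set $I$ is a triple $(X,\star,t)$ with $X$ a nonempty set of elements, $t:X\to I$ a type map, and $\star$ a symmetric reflexive relation on $X$ (incidence) such that distinct incident elements have different types. A flag is a set of pairwise incident elements; its type is the set of types of its elements; a chamber is a flag of type $I$. The incidence system is a geometry if every maximal flag is a chamber. The residue of a flag $F$ is the incidence system formed by the elements not in $F$ that are incident to all elements of $F$; its rank is $|I|-|F|$. A geometry is thin if every flag of type $I\setminus\{i\}$, $i\in I$, is contained in exactly two chambers. It is residually connected if the incidence graph (vertices: elements; edges: pairs of distinct incident elements) of every residue of rank at least $2$ (including the whole geometry, the residue of the empty flag) is connected. A correlation is a bijection $\phi:X\to X$ with $x\star y \iff \phi(x)\star\phi(y)$ and such that $t(x)=t(y)$ implies $t(\phi(x))=t(\phi(y))$; it induces a permutation of $I$, called its type. An automorphism is a correlation preserving all types; $\mathrm{Aut}(\Gamma)$ is the group of automorphisms. A duality is a correlation whose type is a transposition $(i,j)$; a triality is a correlation whose type is a 3-cycle $(i,j,k)$. A geometry is flag transitive if $\mathrm{Aut}(\Gamma)$ is transitive on its chambers. For a group $G$ and subgroups $(G_i)_{i\in I}$, the coset geometry $\Gamma(G,(G_i)_{i\in I})$ has as elements of type $i$ the left cosets $xG_i$, $x\in G$; cosets $xG_i$ and $yG_j$ with $i\neq j$ are incident iff $xG_i\cap yG_j\neq\emptyset$ (and each element is incident to itself). $G$ acts on it by left multiplication. The subgroups $G_i$ are called the maximal parabolics. *)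

(* Defs.v *)
From mathcomp Require Import all_boot all_fingroup all_solvable.

Set Implicit Arguments.
Unset Strict Implicit.
Unset Printing Implicit Defensive.

Import GroupScope.

(* Incidence systems have a finite set of elements here: this is the case of *)
(* every coset geometry of a finite group, and it makes the correlations     *)
(* into elements of the finite group {perm X}.                               *)
Record incidence_system (I : finType) := IncidenceSystem {
  elt :> finType;
  typ : elt -> I;
  inc : rel elt;
  elt_nonempty : 0 < #|elt|;
  inc_refl : reflexive inc;
  inc_sym : symmetric inc;
  inc_typ : forall x y : elt, inc x y -> x != y -> typ x != typ y
}.

Section IncidenceSystems.

Variables (I : finType) (X : incidence_system I).
Implicit Types (x y : X) (F C : {set X}) (phi : {perm X}).

Definition is_flag F := [forall x in F, forall y in F, inc x y].

Definition flag_type F : {set I} := @typ I X @: F.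

Definition is_chamber C := is_flag C && (flag_type C == [set: I]).

Definition is_geometry : Prop :=
  forall F, maxset is_flag F -> is_chamber F.

Definition is_thin : Prop :=
  forall (i : I) F, is_flag F -> flag_type F = ~: [set i] ->
    #|[set C | is_chamber C & F \subset C]| = 2.

(* The element set of the residue of F; its incidence and type map are those *)
(* of X.                                                                     *)
Definition residue F : {set X} :=
  [set x | (x \notin F) && [forall y in F, inc x y]].

Definition residue_rank F : nat := #|I| - #|F|.

Definition incidence_graph (A : {set X}) : rel X :=
  [rel x y | [&& x \in A, y \in A, x != y & inc x y]].

(* The empty graph is not regarded as connected. *)
Definition connected_elts (A : {set X}) : Prop :=
  A != set0 /\ {in A &, forall x y, connect (incidence_graph A) x y}.

Definition residually_connected : Prop :=
  forall F, is_flag F -> 2 <= residue_rank F -> connected_elts (residue F).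

Definition is_correlation phi : bool :=
  [forall x, forall y, inc x y == inc (phi x) (phi y)]
  && [forall x, forall y, (typ x == typ y) ==> (typ (phi x) == typ (phi y))].

Definition has_type phi (s : {perm I}) : Prop :=
  forall x, typ (phi x) = s (typ x).

Definition automorphisms : {set {perm X}} :=
  [set phi | is_correlation phi & [forall x, typ (phi x) == typ x]].

Lemma automorphisms_group_set : group_set automorphisms.
Proof.
apply/group_setP; split.
  rewrite inE; apply/andP; split; last by apply/forallP=> x; rewrite perm1.
  apply/andP; split; apply/forallP=> x; apply/forallP=> y; rewrite !perm1 //.
  exact/implyP.
move=> f g; rewrite !inE => /andP[/andP[/forallP cf /forallP tf] /forallP af].
move=> /andP[/andP[/forallP cg /forallP tg] /forallP ag].
apply/andP; split; last first.
  by apply/forallP=> x; rewrite permM (eqP (ag _)).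
apply/andP; split; apply/forallP=> x; apply/forallP=> y; rewrite !permM.
  by rewrite (eqP (forallP (cf x) y)) (forallP (cg _) _).
by rewrite !(eqP (ag _)) !(eqP (af _)) implybb.
Qed.

Definition automorphism_group : {group {perm X}} :=
  Group automorphisms_group_set.

Definition is_duality phi : Prop :=
  is_correlation phi /\ exists i j : I, i != j /\ has_type phi (tperm i j).

Definition is_triality phi : Prop :=
  is_correlation phi /\
  exists (s : {perm I}) (i j k : I),
    [/\ has_type phi s, uniq [:: i; j; k], perm_on [set i; j; k] s
      & [/\ s i = j, s j = k & s k = i]].

Definition flag_transitive : Prop :=
  [transitive automorphism_group, on [set C | is_chamber C] | ('P)^*].

End IncidenceSystems.

Section CosetGeometry.

(* The type set is 'I_r.+1, i.e., an arbitrary nonempty finite set. *)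
Variables (gT : finGroupType) (G : {group gT}) (r : nat).
Variable Gi : 'I_r.+1 -> {group gT}.

(* Elements are pairs (i, x *: Gi i) with x \in G: keeping the type makes the *)
(* elements of different types distinct even if some parabolics coincide.     *)
Definition coset_elt : finType :=
  {u : 'I_r.+1 * {set gT} | u.2 \in lcosets (Gi u.1) G}.

Definition coset_typ (u : coset_elt) : 'I_r.+1 := (val u).1.

Definition coset_inc : rel coset_elt := fun u v =>
  (u == v) || (coset_typ u != coset_typ v) && ((val u).2 :&: (val v).2 != set0).

Lemma coset_elt_nonempty : 0 < #|coset_elt|.
Proof.
have P : ((ord0 : 'I_r.+1), 1%g *: Gi ord0).2
           \in lcosets (Gi ((ord0 : 'I_r.+1), 1%g *: Gi ord0).1) G.
  by apply/lcosetsP; exists 1%g; rewrite // group1.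
by apply/card_gt0P; exists (Sub (ord0, 1%g *: Gi ord0) P).
Qed.

Lemma coset_inc_refl : reflexive coset_inc.
Proof. by move=> u; rewrite /coset_inc eqxx. Qed.

Lemma coset_inc_sym : symmetric coset_inc.
Proof.
by move=> u v; rewrite /coset_inc eq_sym [in X in _ || X]eq_sym setIC.
Qed.

Lemma coset_inc_typ (u v : coset_elt) :
  coset_inc u v -> u != v -> coset_typ u != coset_typ v.
Proof. by case/orP=> [/eqP-> | /andP[]//]; rewrite eqxx. Qed.

Definition coset_geometry : incidence_system 'I_r.+1 :=
  IncidenceSystem coset_elt_nonempty coset_inc_refl coset_inc_sym coset_inc_typ.

(* Left multiplication. As library actions are right actions, g acts by      *)
(* u |-> g^-1 u; elements outside the domain G of the action act trivially.  *)
Lemma left_mul_subproof (u : coset_elt) (g : gT) :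
  (((val u).1, (if g \in G then g^-1 else 1) *: (val u).2)).2
    \in lcosets (Gi (val u).1) G.
Proof.
case: u => [[i C] /= /lcosetsP[x Gx ->]].
rewrite -lcosetM; apply/lcosetsP; eexists; last by [].
apply: groupM => //; by case: ifP => [Gg | _]; rewrite ?groupV.
Qed.

Definition left_mul (u : coset_geometry) (g : gT) : coset_geometry :=
  Sub ((val u).1, (if g \in G then g^-1 else 1) *: (val u).2)
      (left_mul_subproof u g).

Lemma left_mul_is_action : is_action G left_mul.
Proof.
split=> [g u v /(congr1 val)eq_uv | u g h Gg Gh].
  apply: val_inj; case: u v eq_uv => [[i A] Pu] [[j B] Pv] /= [-> eqAB].
  by congr (_, _); apply: lcoset_inj eqAB.
apply: val_inj; rewrite /= groupM // Gg Gh.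
by rewrite invMg lcosetM.
Qed.

Canonical left_mul_action := Action left_mul_is_action.

End CosetGeometry.

Section Family.

Variable k : nat.

(* The points 1, ..., 13 + 9k are represented by the ordinals 0, ..., 12 + 9k. *)
Definition pt (a : nat) : 'I_(13 + 9 * k) := @inord (12 + 9 * k) a.-1.

Definition transp (a b : nat) : 'S_(13 + 9 * k) := tperm (pt a) (pt b).

(* The library composes permutations from left to right. The opposite        *)
(* convention yields an isomorphic coset geometry, via x |-> x^-1.           *)
Definition rho1 : 'S_(13 + 9 * k) :=
  transp 1 2 * \prod_(i < k.+1) transp (8 + 9 * i) (11 + 9 * i)
             * \prod_(i < k.+1) transp (3 + 9 * i) (6 + 9 * i)
             * \prod_(i < k.+1) transp (7 + 9 * i) (10 + 9 * i).

Definition rho2 : 'S_(13 + 9 * k) :=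
  transp 1 3 * \prod_(i < k.+1) transp (5 + 9 * i) (8 + 9 * i)
             * \prod_(i < k.+1) transp (9 + 9 * i) (12 + 9 * i)
             * \prod_(i < k.+1) transp (4 + 9 * i) (7 + 9 * i).

Definition rho3 : 'S_(13 + 9 * k) :=
  transp 1 4 * \prod_(i < k.+1) transp (2 + 9 * i) (5 + 9 * i)
             * \prod_(i < k.+1) transp (6 + 9 * i) (9 + 9 * i)
             * \prod_(i < k.+1) transp (10 + 9 * i) (13 + 9 * i).

Definition GG : {group 'S_(13 + 9 * k)} := <<[set rho1; rho2; rho3]>>%G.

(* G_1, G_2, G_3 are indexed by 0, 1, 2 : 'I_3. *)
Definition parabolic (i : 'I_3) : {group 'S_(13 + 9 * k)} :=
  match val i with
  | 0 => <<[set rho2; rho3]>>%G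
  | 1 => <<[set rho1; rho3]>>%G
  | _ => <<[set rho1; rho2]>>%G
  end.

Definition Gamma : incidence_system 'I_3 := coset_geometry GG parabolic.

End Family.

(* Main.v *)
(** The three involutions are the colours of a properly 3-edge-coloured tree on
    the n points: three paths of length 4 + 3k issuing from the point 1, whose
    colour sequences are 3-periodic and permuted cyclically by the rotation of
    the paths.  This rotation normalises G and permutes rho_1, rho_2, rho_3
    cyclically, whence a triality.  Two colours leave components that are paths
    with at most 4 vertices; so each maximal parabolic is dihedral of order 24,
    and it moves the points near the centre only to points of the ball of radius
    4, which is the same tree for all k.  A finite computation in this ball
    gives the intersections of the parabolics and the equality
    G_1 /\ G_2 G_3 = (G_1 /\ G_2) (G_1 /\ G_3), so that chambers correspond to
    the elements of G.

    A correlation is determined by its type and by the image of one chamber.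
    Hence Aut(Gamma) = G, and a duality would map every relation in rho_1,
    rho_2, rho_3 to a relation; one relation that depends on the cyclic
    order of the colours excludes this.  Finally (rho_1 rho_2)^6 is a double
    transposition near the centre; two of its conjugates sharing a single point
    give a 3-cycle in G, and moving this 3-cycle along the edges gives A_n.  *)

Require Import Defs.
From mathcomp Require Import all_boot all_fingroup all_solvable.
From mathcomp Require Import zify.

Set Implicit Arguments.
Unset Strict Implicit.
Unset Printing Implicit Defensive.

Import GroupScope.

(** * Generation *)

Lemma gen_mulr_ind (gT : finGroupType) (A : {set gT}) (P : gT -> Prop) :
  P 1 -> (forall x a, x \in <<A>> -> a \in A -> P x -> P (x * a)) ->
  {in <<A>>, forall x, P x}.
Proof.
move=> P1 PM x /gen_prodgP[n [c Ac ->]].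
suff [] : P (\prod_(i < n) c i) /\ \prod_(i < n) c i \in <<A>> by [].
elim: n c Ac => [|n IHn] c Ac; first by rewrite big_ord0.
rewrite big_ord_recr /=.
have [|IH1 IH2] := IHn (fun i => c (widen_ord (leqnSn n) i)) => [i|].
  exact: Ac.
by split; [apply: PM | rewrite groupM // mem_gen].
Qed.

(** Normal form in a dihedral group: a rotation, then possibly [s]. The bound [m] may be any
    multiple of the order of [s * t]. *)
Lemma gen_involutions (gT : finGroupType) (s t : gT) m x :
  0 < m -> s * s = 1 -> t * t = 1 -> (s * t) ^+ m = 1 -> x \in <<[set s; t]>> ->
  exists a (b : bool), a < m /\ x = (s * t) ^+ a * s ^+ b.
Proof.
move=> m0 ss tt pm; elim/gen_mulr_ind: x / => [|x y _ /set2P yst [a [b [am ->]]]].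
  by exists 0, false; rewrite mulg1.
have tE : t = (s * t)^-1 * s by rewrite invMg mulgKV; apply: (mulIg t); rewrite tt mulVg.
have pmod c : (s * t) ^+ (c %% m) = (s * t) ^+ c by rewrite expg_mod.
case: yst b => -> [].
- by exists a, false; rewrite -mulgA ss.
- by exists a, true; rewrite !mulg1.
- by exists (a.+1 %% m), false; rewrite ltn_mod m0 pmod /= expg1 mulg1 expgSr !mulgA.
(* Here [t] is multiplied to a pure rotation: [t = (s * t)^-1 * s], and the inverse is the power
   [m.-1]. *)
exists ((a + m.-1) %% m), true; rewrite ltn_mod m0 pmod; split=> //.
rewrite expg0 mulg1 expgD -mulgA; congr (_ * _); rewrite [LHS]tE; congr (_ * _).
by apply: (mulIg (s * t)); rewrite mulVg -expgSr prednK.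
Qed.

(** * Coset geometries of groups generated by involutions *)

Section CosetGeometryTheory.

Variables (gT : finGroupType) (G : {group gT}) (r : nat).
Variable Gi : 'I_r.+1 -> {group gT}.
Hypothesis sGiG : forall i, Gi i \subset G.

Local Notation X := (coset_geometry G Gi).

Lemma coset_in_subproof (i : 'I_r.+1) (g : gT) :
  (i, (if g \in G then g else 1) *: Gi i).2
    \in lcosets (Gi (i, (if g \in G then g else 1) *: Gi i).1) G.
Proof. by apply/lcosetsP; exists (if g \in G then g else 1); case: ifP. Qed.

(* Outside [G] the representative is replaced by 1. *)
Definition coset_in i g : X :=
  Sub (i, (if g \in G then g else 1) *: Gi i) (coset_in_subproof i g).

Arguments coset_in : simpl never.

Lemma val_coset_in i g : g \in G -> val (coset_in i g) = (i, g *: Gi i).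
Proof. by move=> Gg; rewrite /coset_in /= Gg. Qed.

Lemma coset_in_eq i g h : g \in G -> h \in G ->
  (coset_in i g == coset_in i h) = (g^-1 * h \in Gi i).
Proof.
move=> Gg Gh; rewrite -val_eqE !val_coset_in // xpair_eqE eqxx /=.
by rewrite -mem_lcoset; apply/eqP/lcoset_eqP=> ->.
Qed.

Lemma coset_in_mulr i g x : g \in G -> x \in Gi i ->
  coset_in i (g * x) = coset_in i g.
Proof.
move=> Gg Hx; have Gx := subsetP (sGiG i) _ Hx.
by apply/esym/eqP; rewrite (coset_in_eq _ Gg (groupM Gg Gx)) mulKg.
Qed.

Lemma mem_coset_elt (u : X) g :
  (g \in (val u).2) = (g \in G) && (u == coset_in (typ u) g).
Proof.
have /lcosetsP[x Gx defC] := valP u.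
have Eu : u = coset_in (typ u) x.
  by apply: val_inj; rewrite val_coset_in // [LHS]surjective_pairing defC.
rewrite defC mem_lcoset -/(typ u); case: (boolP (g \in G)) => [Gg | nGg] /=.
  by rewrite [in X in _ = X]Eu coset_in_eq.
apply: contraNF nGg => /(subsetP (sGiG _)) Gxg.
by rewrite -(mulKVg x g) groupM.
Qed.

Lemma coset_inP (u : X) : exists2 g, g \in G & u = coset_in (typ u) g.
Proof.
have /lcosetsP[x Gx defC] := valP u.
have : x \in (val u).2 by rewrite defC lcoset_refl.
by rewrite mem_coset_elt Gx => /eqP ->; exists x.
Qed.

(** Incidence as a common representative. Reflexivity is covered as well, since cosets of equal type
    sharing an element coincide. *)
Lemma incP (u v : X) :
  reflect (exists2 g, g \in G & u = coset_in (typ u) g /\ v = coset_in (typ v) g)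
          (inc u v).
Proof.
apply: (iffP orP) => [[/eqP <- | /andP[_ /set0Pn[g]]] | [g Gg [Eu Ev]]].
- by have [g Gg Eu] := coset_inP u; exists g.
- rewrite inE !mem_coset_elt => /andP[/andP[Gg /eqP Eu] /andP[_ /eqP Ev]].
  by exists g.
case: (eqVneq (typ u) (typ v)) => [Euv | neq]; [left | right].
  by rewrite Eu Ev Euv.
apply/andP; split=> //; apply/set0Pn; exists g.
by rewrite inE !mem_coset_elt Gg -Eu -Ev !eqxx.
Qed.

Definition std_chamber g : {set X} := [set coset_in i g | i : 'I_r.+1].

Lemma std_chamber_flag g : g \in G -> is_flag (std_chamber g).
Proof.
move=> Gg; apply/forall_inP=> _ /imsetP[i _ ->].
by apply/forall_inP=> _ /imsetP[j _ ->]; apply/incP; exists g.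
Qed.

Lemma std_chamber_chamber g : g \in G -> is_chamber (std_chamber g).
Proof.
move=> Gg; rewrite /is_chamber std_chamber_flag //=; apply/eqP/setP=> i.
by rewrite inE; apply/imsetP; exists (coset_in i g); first exact: imset_f.
Qed.

Lemma mem_std_chamber g u : (u \in std_chamber g) = (u == coset_in (typ u) g).
Proof.
apply/imsetP/eqP => [[i _ ->] // | ->].
by exists (typ u).
Qed.

Lemma coset_in_left_mul i x g : x \in G -> g \in G ->
  left_mul (coset_in i x) g = coset_in i (g^-1 * x).
Proof.
move=> Gx Gg; apply: val_inj.
by rewrite val_coset_in ?groupM ?groupV //= Gg Gx lcosetM.
Qed.

Local Notation to := (left_mul_action G Gi).

Lemma actperm_coset_in i x g : x \in G -> g \in G ->
  actperm to g (coset_in i x) = coset_in i (g^-1 * x).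
Proof. by move=> Gx Gg; rewrite actpermE -coset_in_left_mul. Qed.

Lemma actperm_automorphism g : g \in G ->
  actperm to g \in automorphism_group X.
Proof.
move=> Gg.
have typE u : typ (actperm to g u) = typ u.
  by have [x Gx ->] := coset_inP u; rewrite actperm_coset_in.
have incE u v : inc u v = inc (actperm to g u) (actperm to g v).
  apply/incP/incP=> [] [x Gx [Eu Ev]].
    exists (g^-1 * x); first by rewrite groupM ?groupV.
    by rewrite !typE; split; rewrite [in LHS](Eu, Ev) actperm_coset_in.
  exists (g * x); first by rewrite groupM.
  rewrite !typE in Eu Ev.
  by split; apply: (@perm_inj _ (actperm to g));
    rewrite (Eu, Ev) actperm_coset_in ?groupM // mulKg.
rewrite inE; apply/andP; split; last by apply/forallP=> u; rewrite typE.
apply/andP; split; apply/forallP=> u; apply/forallP=> v; first by rewrite -incE.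
by rewrite !typE; apply/implyP.
Qed.

(** Pairwise intersecting cosets need not have a common element. Where they do, every flag extends
    to some [std_chamber g], and chambers are the translates of one chamber. *)
Hypothesis flag_common : forall F : {set X}, is_flag F ->
  exists2 g, g \in G & {in F, forall u, u = coset_in (typ u) g}.

Lemma chamberP (C : {set X}) :
  reflect (exists2 g, g \in G & C = std_chamber g) (is_chamber C).
Proof.
apply: (iffP idP) => [|[g Gg ->]]; last exact: std_chamber_chamber.
case/andP=> /flag_common[g Gg comF] /eqP tC; exists g => //; apply/setP=> u.
rewrite mem_std_chamber; apply/idP/eqP=> [|Eu]; first exact: comF.
have /imsetP[v Cv tv] : typ u \in flag_type C by rewrite tC inE.
by rewrite Eu tv -comF.
Qed.

Lemma coset_geometry_geometry : is_geometry X.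
Proof.
move=> F /maxsetP[flagF maxF]; have [g Gg comF] := flag_common flagF.
rewrite -(maxF (std_chamber g)); first exact: std_chamber_chamber.
  exact: std_chamber_flag.
by apply/subsetP=> u /comF Eu; rewrite mem_std_chamber -Eu.
Qed.

Lemma coset_geometry_flag_transitive : flag_transitive X.
Proof.
apply/imsetP; exists (std_chamber 1); first by rewrite inE std_chamber_chamber.
apply/setP=> C; rewrite inE; apply/chamberP/orbitP=> [[g Gg ->] | [phi]].
  (* The action of an element is left multiplication by its inverse, so [g^-1] carries the chamber
     of 1 to that of [g]. *)
  exists (actperm to g^-1); first by rewrite actperm_automorphism ?groupV.
  have actE i : ('P)%act (coset_in i 1) (actperm to g^-1) = coset_in i g.
    by rewrite /= apermE actperm_coset_in ?groupV // invgK mulg1.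
  apply/setP=> u; rewrite mem_std_chamber; apply/imsetP/eqP.
    by case=> _ /imsetP[i _ ->] ->; rewrite !actE.
  by move=> ->; exists (coset_in (typ u) 1); [apply: imset_f | rewrite actE].
move=> Aphi <-.
apply/chamberP.
move: Aphi; rewrite inE => /andP[/andP[/forallP incE _] /forallP typE].
rewrite /is_chamber; apply/andP; split.
  apply/forall_inP=> _ /imsetP[u Cu ->]; apply/forall_inP=> _ /imsetP[v Cv ->].
  rewrite -[inc _ _]/(inc (aperm u phi) (aperm v phi)) !apermE.
  rewrite -(eqP (forallP (incE _) _)).
  exact: (forall_inP (forall_inP (std_chamber_flag (group1 G)) u Cu)).
apply/eqP/setP=> i; rewrite inE; apply/imsetP.
exists (phi (coset_in i 1)); last by rewrite (eqP (typE _)).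
by apply/imsetP; exists (coset_in i 1); rewrite ?apermE //; apply: imset_f.
Qed.

(** * Thinness and residual connectedness from the intersection property *)

Variable rho : 'I_r.+1 -> gT.
Hypothesis rhoK : forall i, rho i * rho i = 1.
Hypothesis rho_neq1 : forall i, rho i != 1.
(** The intersection property. For empty [J] the intersection is the whole type [gT], so the factor
    [G] makes this case say that [rho] generates [G]. *)
Hypothesis bigcap_parabolic : forall J : {set 'I_r.+1},
  G :&: \bigcap_(j in J) Gi j = <<rho @: ~: J>>.

Lemma rho_in i : rho i \in G.
Proof.
have := bigcap_parabolic set0; rewrite big_set0 setIT => ->.
by rewrite mem_gen // imset_f // !inE.
Qed.

Lemma rho_in_parabolic i j : j != i -> rho i \in Gi j.
Proof.
move=> neq; have /setP/(_ (rho i)) := bigcap_parabolic [set j].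
rewrite big_set1 inE rho_in /= => ->.
by rewrite mem_gen // imset_f // !inE eq_sym.
Qed.

Lemma mem_bigcap_parabolic (J : {set 'I_r.+1}) x :
  x \in G -> {in J, forall j, x \in Gi j} -> x \in <<rho @: ~: J>>.
Proof.
move=> Gx Jx; rewrite -bigcap_parabolic inE Gx /=; exact/bigcapP.
Qed.

(** All parabolics together meet in 1, so a chamber determines its element of [G]. *)
Lemma parabolics_separate g h : g \in G -> h \in G ->
  (forall i, coset_in i g = coset_in i h) -> g = h.
Proof.
move=> Gg Gh E; have : g^-1 * h \in <<rho @: ~: setT>>.
  apply: mem_bigcap_parabolic => [|j _]; first by rewrite groupM ?groupV.
  by rewrite -coset_in_eq // E.
rewrite setCT imset0 gen0 => /set1gP E1.
by rewrite -[h](mulKVg g) E1 mulg1.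
Qed.

(** The parabolics of types other than [i] meet in the group of order 2 generated by [rho i]; this
    is the source of thinness. *)
Lemma adjacent_cosets i g h : g \in G -> h \in G ->
  (forall j, j != i -> coset_in j g = coset_in j h) -> h = g \/ h = g * rho i.
Proof.
move=> Gg Gh E.
have : g^-1 * h \in <<rho @: ~: ~: [set i]>>.
  apply: mem_bigcap_parabolic => [|j]; first by rewrite groupM ?groupV.
  by rewrite !inE => ne_ji; rewrite -coset_in_eq // E.
rewrite setCK imset_set1 -/(cycle _) cycle2g.
  by case/set2P=> E1; [left | right]; rewrite -[h](mulKVg g) E1 ?mulg1.
by apply: nt_prime_order => //; rewrite expgS expg1 rhoK.
Qed.

Lemma rho_notin_parabolic i : rho i \notin Gi i.
Proof.
apply/negP=> Hi; case/eqP: (rho_neq1 i).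
apply: parabolics_separate; rewrite ?rho_in // => j.
apply/esym; rewrite -[rho i]mul1g coset_in_mulr //.
by case: (eqVneq j i) => [-> // | /rho_in_parabolic].
Qed.

Lemma coset_geometry_thin : is_thin X.
Proof.
move=> i F flagF tF; have [g Gg comF] := flag_common flagF.
have -> : [set C | is_chamber C & F \subset C]
        = [set std_chamber g; std_chamber (g * rho i)].
  apply/setP=> C; rewrite in_set2 inE; apply/andP/orP.
    case=> /chamberP[h Gh ->] sFC.
    have E j : j != i -> coset_in j g = coset_in j h.
      move=> ne_ji; have : j \in flag_type F by rewrite tF !inE.
      case/imsetP=> u Fu ->; rewrite -(comF u Fu); apply/eqP.
      by rewrite -mem_std_chamber (subsetP sFC).
    by case: (adjacent_cosets Gg Gh E) => ->; [left | right].
  have sub h : (forall j, j != i -> coset_in j h = coset_in j g) ->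
      F \subset std_chamber h.
    move=> E; apply/subsetP=> u Fu; rewrite mem_std_chamber E -?comF //.
    by have := imset_f (@typ _ X) Fu; rewrite -/(flag_type F) tF !inE.
  case=> /eqP ->; split; try by apply: sub.
  - exact: std_chamber_chamber.
  - by apply: std_chamber_chamber; rewrite groupM ?rho_in.
  by apply: sub => j /rho_in_parabolic; apply: coset_in_mulr.
rewrite cards2; case: eqP => //= E.
case/eqP: (rho_neq1 i); apply: (mulgI g); rewrite mulg1.
apply: parabolics_separate; rewrite ?groupM ?rho_in // => j.
have : coset_in j (g * rho i) \in std_chamber g by rewrite E; apply: imset_f.
by rewrite mem_std_chamber => /eqP.
Qed.

Lemma gen_rho_ind (J : {set 'I_r.+1}) (P : gT -> Prop) :
  P 1 -> (forall x i, i \in J -> x \in <<rho @: J>> -> P x -> P (x * rho i)) ->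
  {in <<rho @: J>>, forall x, P x}.
Proof.
move=> P1 PM; apply: gen_mulr_ind => // x _ Jx /imsetP[i Ji ->]; exact: PM.
Qed.

Lemma flag_coset_card (F : {set X}) : is_flag F -> #|F| = #|flag_type F|.
Proof.
move=> flagF; have [g Gg comF] := flag_common flagF.
by rewrite card_in_imset // => u v Fu Fv tuv; rewrite (comF u Fu) (comF v Fv) tuv.
Qed.

Lemma connect_chamber (A : {set X}) i j g : g \in G ->
  coset_in i g \in A -> coset_in j g \in A ->
  connect (incidence_graph A) (coset_in i g) (coset_in j g).
Proof.
move=> Gg Ai Aj; case: (eqVneq (coset_in i g) (coset_in j g)) => [-> // | ne].
by apply/connect1/and4P; split=> //; apply/incP; exists g.
Qed.

(** If [g] represents all of [F], the residue consists of cosets of elements [g * x] with [x]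
    generated by the [rho l], [l] outside the type of [F]. A path follows a word for [x]: a step by
    [rho l] fixes the coset of another type [m] outside the type of [F], which exists because the
    rank is at least 2. *)
Lemma coset_geometry_residually_connected : residually_connected X.
Proof.
move=> F flagF; rewrite /residue_rank flag_coset_card // => rk.
set J := flag_type F in rk.
have rkC : 1 < #|~: J| by rewrite cardsCs setCK.
have resE g : g \in G -> {in F, forall u, u = coset_in (typ u) g} ->
    forall i, i \notin J -> coset_in i g \in residue F.
  move=> Gg comF i J'i; rewrite inE; apply/andP; split.
    by apply: contra J'i => Fi; apply/imsetP; exists (coset_in i g).
  by apply/forall_inP=> u Fu; apply/incP; exists g => //; split=> //; apply: comF.
have resP u : u \in residue F -> typ u \notin J /\
    exists2 g, g \in G & u = coset_in (typ u) g
                         /\ {in F, forall v, v = coset_in (typ v) g}.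
  rewrite inE => /andP[F'u /forall_inP incu]; split.
    apply: contra F'u => /imsetP[v Fv tuv].
    case: (eqVneq u v) => [-> // | ne].
    by have := inc_typ (incu v Fv) ne; rewrite tuv eqxx.
  have [|g Gg comF] := flag_common (F := u |: F).
    apply/forall_inP=> v /setU1P[-> | Fv]; apply/forall_inP=> w /setU1P[-> | Fw].
    - exact: inc_refl.
    - exact: incu.
    - by rewrite inc_sym incu.
    exact: (forall_inP (forall_inP flagF v Fv)).
  exists g => //; split=> [|v Fv]; apply: comF; first exact: setU11.
  exact: setU1r.
split.
  have [g Gg comF] := flag_common flagF.
  have /card_gt0P[i] : 0 < #|~: J| by apply: ltnW.
  by rewrite inE => J'i; apply/set0Pn; exists (coset_in i g); apply: resE.
move=> u v /resP[J'u [g Gg [Eu comg]]] /resP[J'v [h Gh [Ev comh]]].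
rewrite Eu Ev; move: (typ u) (typ v) J'u J'v => i j J'i J'j {u v Eu Ev}.
have Jh : g^-1 * h \in <<rho @: ~: J>>.
  apply: mem_bigcap_parabolic => [|l]; first by rewrite groupM ?groupV.
  case/imsetP=> w Fw ->; rewrite -coset_in_eq //.
  by rewrite -comg // -comh.
have sJG : {subset <<rho @: ~: J>> <= G}.
  by move=> x; rewrite -bigcap_parabolic => /setIP[].
have comM x : x \in <<rho @: ~: J>> ->
    {in F, forall w, w = coset_in (typ w) (g * x)}.
  rewrite -bigcap_parabolic => /setIP[Gx /bigcapP Jx] w Fw.
  by rewrite coset_in_mulr //; [apply: comg | apply/Jx/imset_f].
have defh : h = g * (g^-1 * h) by rewrite mulKVg.
rewrite defh {defh}; move: (g^-1 * h) Jh => x Jx {h Gh comh}.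
elim/gen_rho_ind: x / Jx j J'j => [|x l J'l Jx IHx] j J'j.
  by rewrite mulg1; apply: connect_chamber; rewrite // resE.
have Gx := sJG x Jx.
have Jxl : x * rho l \in <<rho @: ~: J>> by rewrite groupM // mem_gen // imset_f.
have [m J'm ne_ml] : exists2 m, m \notin J & m != l.
  have : 0 < #|(~: J) :\ l| by move: rkC; rewrite (cardsD1 l) J'l.
  by case/card_gt0P=> m; rewrite !inE => /andP[ne_ml J'm]; exists m.
apply: connect_trans (IHx m J'm) _.
rewrite -(coset_in_mulr (groupM Gg Gx) (rho_in_parabolic ne_ml)) -mulgA.
have GM : g * (x * rho l) \in G by rewrite !groupM ?rho_in.
by apply: connect_chamber; rewrite ?resE //; apply: comM.
Qed.

(** * Correlations and the automorphism group *)

Lemma correlation_std_chamber (phi : {perm X}) s : is_correlation phi ->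
  has_type phi s -> forall g, g \in G ->
  exists2 h, h \in G & forall i, phi (coset_in i g) = coset_in (s i) h.
Proof.
case/andP=> /forallP incE _ typE g Gg.
have [|h Gh comF] := flag_common (F := phi @: std_chamber g).
  apply/forall_inP=> _ /imsetP[u Cu ->]; apply/forall_inP=> _ /imsetP[v Cv ->].
  rewrite -(eqP (forallP (incE _) _)).
  exact: (forall_inP (forall_inP (std_chamber_flag Gg) u Cu)).
exists h => // i; have Ci : coset_in i g \in std_chamber g by rewrite mem_std_chamber.
by rewrite (comF _ (imset_f phi Ci)) typE.
Qed.

Definition word (w : seq 'I_r.+1) : gT := \prod_(c <- w) rho c.

Lemma word_in w : word w \in G.
Proof. by apply: group_prod => i _; apply: rho_in. Qed.

(* A correlation maps i-adjacent chambers to s(i)-adjacent ones, so it is     *)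
(* determined by its type and by the image of one chamber.                    *)
Lemma correlation_word (phi : {perm X}) s : is_correlation phi ->
  has_type phi s -> exists2 h, h \in G &
    forall w i, phi (coset_in i (word w)) = coset_in (s i) (h * word (map s w)).
Proof.
move=> cor typE; have ch := correlation_std_chamber cor typE.
have [h Gh E1] := ch 1 (group1 G); exists h => // w.
elim/last_ind: w => [|w c IHw]; first by rewrite /word /= !big_nil mulg1.
have wE v l : word (rcons v l) = word v * rho l by rewrite /word -cats1 big_cat big_seq1.
rewrite map_rcons !wE mulgA.
set g1 := word w in IHw *; set g2 := h * _ in IHw *.
have Gg1 : g1 \in G := word_in w.
have Gg2 : g2 \in G by rewrite groupM ?word_in.
have [h' Gh' E] := ch _ (groupM Gg1 (rho_in c)).
suff <- : h' = g2 * rho (s c) by [].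
(* The new image chamber agrees with the old one outside type [s c], so it is the old one or its
   neighbour. The former would put [rho c] into [Gi c], by injectivity of [phi]. *)
have adj j : j != s c -> coset_in j g2 = coset_in j h'.
  move=> ne_j; rewrite -[j](permKV s) -E -IHw; congr (phi _).
  apply/esym/coset_in_mulr/rho_in_parabolic => //.
  by apply: contra ne_j => /eqP <-; rewrite permKV.
case: (adjacent_cosets Gg2 Gh' adj) => // eq_h.
case/negP: (rho_notin_parabolic c).
rewrite -(mulKg g1 (rho c)) -coset_in_eq ?groupM ?rho_in //.
by apply/eqP/(@perm_inj _ phi); rewrite E IHw eq_h.
Qed.

(** A relation is a closed walk through adjacent chambers; its image is again closed, with the types
    permuted by [s]. *)
Lemma correlation_relation (phi : {perm X}) s w : is_correlation phi ->
  has_type phi s -> word w = 1 -> word (map s w) = 1.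
Proof.
move=> cor typE w1; have [h Gh E] := correlation_word cor typE.
apply: (mulgI h); rewrite mulg1.
apply: parabolics_separate; rewrite ?groupM ?word_in // => j.
have := E w (s^-1 j); have := E [::] (s^-1 j).
by rewrite w1 /word !big_nil mulg1 permKV => -> ->.
Qed.

Lemma gen_rho_word g : g \in G -> exists w, g = word w.
Proof.
have := bigcap_parabolic set0; rewrite big_set0 setIT setC0 => -> Gg.
elim/gen_rho_ind: g / Gg => [|g i _ _ [w ->]].
  by exists [::]; rewrite /word big_nil.
by exists (rcons w i); rewrite /word -cats1 big_cat big_seq1.
Qed.

(** An automorphism has trivial type, so by [correlation_word] it is left multiplication by the [h]
    to which it sends 1. *)
Lemma automorphism_group_left_mul :
  automorphism_group X :=: actperm to @* G.
Proof.
apply/setP=> phi; apply/idP/idP => [Aphi | /morphimP[g _ Gg ->]]; last first.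
  exact: actperm_automorphism.
have [cor /forallP typE] : is_correlation phi /\ [forall x, typ (phi x) == typ x].
  by move: Aphi; rewrite inE => /andP.
have typ1 : has_type phi 1 by move=> u; rewrite perm1; apply/eqP.
have [h Gh E] := correlation_word cor typ1.
apply/morphimP; exists h^-1; rewrite ?groupV //; apply/permP=> u.
have [g Gg ->] := coset_inP u; rewrite actperm_coset_in ?groupV // invgK.
have [w ->] := gen_rho_word Gg; rewrite E perm1; congr (coset_in _ (_ * word _)).
by rewrite (eq_map (fun i => perm1 i)) map_id.
Qed.

Lemma left_mul_faithful : [faithful G, on [set: X] | to].
Proof.
apply/subsetP=> g /setIP[Gg Cg]; apply/set1gP/invg_inj; rewrite invg1.
apply: parabolics_separate; rewrite ?groupV // => i.
by have /= := astab_act Cg (in_setT (coset_in i 1)); rewrite coset_in_left_mul // mulg1.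
Qed.

Lemma automorphism_group_isog : automorphism_group X \isog G.
Proof.
rewrite automorphism_group_left_mul isog_sym sub_isog //.
rewrite ker_actperm; apply/subsetP=> g Cg.
have Gg : g \in G by move: Cg; rewrite inE => /andP[].
apply: (subsetP left_mul_faithful).
by rewrite inE Gg.
Qed.

End CosetGeometryTheory.

Arguments coset_in {gT G r Gi} i g : simpl never.

Section Words.

Variables (gT : finGroupType) (r : nat) (rho : 'I_r.+1 -> gT).
Hypothesis rhoK : forall i, rho i * rho i = 1.

Lemma word_cat u v : word rho (u ++ v) = word rho u * word rho v.
Proof. exact: big_cat. Qed.

Lemma word_rev w : word rho (rev w) = (word rho w)^-1.
Proof.
elim: w => [|c w IHw]; first by rewrite /word !big_nil invg1.
rewrite rev_cons -cats1 word_cat IHw /word big_seq1 big_cons invMg.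
by congr (_ * _); apply: (mulgI (rho c)); rewrite rhoK mulgV.
Qed.

Lemma word_nseq m u : word rho (flatten (nseq m u)) = word rho u ^+ m.
Proof.
elim: m => [|m IHm] /=; first by rewrite /word big_nil.
by rewrite word_cat IHm expgS.
Qed.

Lemma word_dihedral c d a (b : bool) :
  word rho (flatten (nseq a [:: c; d]) ++ nseq b c) = (rho c * rho d) ^+ a * rho c ^+ b.
Proof.
rewrite word_cat word_nseq /word !big_cons big_nil mulg1; congr (_ * _).
by case: b; rewrite /= ?big_seq1 ?big_nil.
Qed.

End Words.

(** * Rank three *)

Definition ty0 : 'I_3 := Ordinal (isT : 0 < 3).
Definition ty1 : 'I_3 := Ordinal (isT : 1 < 3).
Definition ty2 : 'I_3 := Ordinal (isT : 2 < 3).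

Lemma ordS_ty : ((ordS ty0 = ty1) * (ordS ty1 = ty2) * (ordS ty2 = ty0))%type.
Proof. by do 2?[split]; apply: val_inj. Qed.

Lemma ord3P (i : 'I_3) : [\/ i = ty0, i = ty1 | i = ty2].
Proof.
by case: i => [[|[|[|//]]] p]; [apply: Or31 | apply: Or32 | apply: Or33]; apply: val_inj.
Qed.

Lemma setC_ty : ((~: [set ty0] = [set ty1; ty2]) * (~: [set ty1] = [set ty0; ty2])
  * (~: [set ty2] = [set ty0; ty1]))%type.
Proof. by do 2?[split]; apply/setP=> j; case: (ord3P j) => ->; rewrite !inE. Qed.

Section RankThreeFlags.

Variables (gT : finGroupType) (G : {group gT}) (Gi : 'I_3 -> {group gT}).
Hypothesis sGiG : forall i, Gi i \subset G.
(** With types numbered from 0, this is the inclusion of [G_0] /\ [G_1 G_2] in ([G_0] /\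
    [G_1])([G_0] /\ [G_2]). *)
Hypothesis factor : forall a b, a \in Gi ty1 -> b \in Gi ty2 -> a * b \in Gi ty0 ->
  exists2 u, u \in Gi ty0 :&: Gi ty1 & u^-1 * (a * b) \in Gi ty2.

Local Notation X := (coset_geometry G Gi).

(** Only flags with all three types need [factor]. Let [g], [h], [l] represent the pairs of types
    01, 02, 12; then [g^-1 * h] is the product of [g^-1 * l] and [l^-1 * h], and the factor [x]
    obtained from it corrects [g] to a representative of all three. *)
Lemma flag_common_rank3 (F : {set X}) : is_flag F ->
  exists2 g, g \in G & {in F, forall u, u = coset_in (typ u) g}.
Proof.
move=> /forall_inP flagF.
have incF u v : u \in F -> v \in F -> inc u v by move=> Fu; apply/forall_inP/flagF.
have typF u v : u \in F -> v \in F -> typ u = typ v -> u = v.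
  move=> Fu Fv tuv; apply/eqP; apply: contraTT isT => /(inc_typ (incF u v Fu Fv)).
  by rewrite tuv eqxx.
have hasP i : (exists2 u, u \in F & typ u = i) \/ (forall u, u \in F -> typ u <> i).
  case: (pickP [pred u in F | typ u == i]) => [u /andP[Fu /eqP tu] | no].
    by left; exists u.
  by right=> u Fu tu; have /negP[] := negbT (no u); apply/andP; split=> //; apply/eqP.
have two i j l : (forall m, [|| m == i, m == j | m == l]) ->
    (forall u, u \in F -> typ u <> l) ->
    exists2 g, g \in G & {in F, forall u, u = coset_in (typ u) g}.
  move=> ijl nol.
  have red g : (forall u, u \in F -> typ u = i -> u = coset_in (typ u) g) ->
      (forall u, u \in F -> typ u = j -> u = coset_in (typ u) g) ->
      {in F, forall u, u = coset_in (typ u) g}.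
    move=> Ei Ej u Fu; case/or3P: (ijl (typ u)) => /eqP tu; auto.
    by case: (nol u).
  case: (hasP i) => [[u Fu tu] | noi]; case: (hasP j) => [[v Fv tv] | noj].
  - have /(incP sGiG)[g Gg [Eu Ev]] := incF u v Fu Fv.
    exists g => //; apply: red => w Fw tw.
      by rewrite -(typF u w) // tu tw.
    by rewrite -(typF v w) // tv tw.
  - have [g Gg Eu] := coset_inP sGiG u; exists g => //; apply: red => w Fw tw.
      by rewrite -(typF u w) // tu tw.
    by case: (noj w).
  - have [g Gg Ev] := coset_inP sGiG v; exists g => //; apply: red => w Fw tw.
      by case: (noi w).
    by rewrite -(typF v w) // tv tw.
  exists 1; first exact: group1.
  by apply: red => w Fw tw; [case: (noi w Fw) | case: (noj w Fw)].
case: (hasP ty0) => [[u0 Fu0 tu0] | no]; last first.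
  by apply: (two ty1 ty2) no => m; case: (ord3P m) => ->; rewrite ?eqxx ?orbT.
case: (hasP ty1) => [[u1 Fu1 tu1] | no]; last first.
  by apply: (two ty0 ty2) no => m; case: (ord3P m) => ->; rewrite ?eqxx ?orbT.
case: (hasP ty2) => [[u2 Fu2 tu2] | no]; last first.
  by apply: (two ty0 ty1) no => m; case: (ord3P m) => ->; rewrite ?eqxx ?orbT.
have /(incP sGiG)[g Gg [Eg0 Eg1]] := incF _ _ Fu0 Fu1.
have /(incP sGiG)[h Gh [Eh0 Eh2]] := incF _ _ Fu0 Fu2.
have /(incP sGiG)[l Gl [El1 El2]] := incF _ _ Fu1 Fu2.
rewrite tu0 tu1 tu2 in Eg0 Eg1 Eh0 Eh2 El1 El2.
have Z0 : g^-1 * h \in Gi ty0 by rewrite -(@coset_in_eq _ G) // -Eg0 -Eh0.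
have Z1 : g^-1 * l \in Gi ty1 by rewrite -(@coset_in_eq _ G) // -Eg1 -El1.
have Z2 : l^-1 * h \in Gi ty2 by rewrite -(@coset_in_eq _ G) // -El2 -Eh2.
have EZ : g^-1 * h = g^-1 * l * (l^-1 * h) by rewrite -mulgA mulKVg.
rewrite EZ in Z0; have [x /setIP[X0 X1]] := factor Z1 Z2 Z0; rewrite -EZ => X2.
have Gx : x \in G := subsetP (sGiG _) _ X0.
exists (g * x); first exact: groupM.
move=> u Fu; case: (ord3P (typ u)) => tu.
- by rewrite -(typF u0 u) // ?tu0 // coset_in_mulr.
- by rewrite -(typF u1 u) // ?tu1 // coset_in_mulr.
rewrite -(typF u2 u) // ?tu2 // {1}Eh2; apply/esym/eqP.
rewrite coset_in_eq //; last exact: groupM.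
by rewrite invMg -mulgA.
Qed.

End RankThreeFlags.

(** * The coloured tree *)

(* Residues modulo 9 of the labels [a.+1] whose edge of colour [c] leads away  *)
(* from, resp. towards, the centre.                                           *)
Definition up_res c : seq nat :=
  match c with 0 => [:: 3; 7; 8] | 1%N => [:: 0; 4; 5] | _ => [:: 1%N; 2; 6] end.

Definition down_res c : seq nat :=
  match c with 0 => [:: 1%N; 2; 6] | 1%N => [:: 3; 7; 8] | _ => [:: 0; 4; 5] end.

(** The generator of colour [c] on points numbered from 0. The centre 0 is joined to [c.+1], every
    other edge joins some [a] to [a + 3], and the bound cuts the arms off at their ends. *)
Definition tree_step k c a : nat :=
  if a == 0 then c.+1 else if a == c.+1 then 0
  else if (a.+1 %% 9 \in up_res c) && (a + 3 < 13 + 9 * k) then a + 3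
  else if (a.+1 %% 9 \in down_res c) && (3 < a) then a - 3 else a.

(* [lstep] follows [tree_step] on the ball of the 13 points common to all      *)
(* trees, and is undefined when the path leaves this ball.                     *)
Definition lstep c a : option nat :=
  let b := tree_step 1 c a in if b < 13 then Some b else None.

Fixpoint run (w : seq 'I_3) a : option nat :=
  if w is c :: w' then obind (run w') (lstep c a) else Some a.

Definition ball_table w := [seq run w a | a <- iota 0 13].

(* Undefined values are regarded as equal to all others. *)
Definition opt_eq (x y : option nat) :=
  if x is Some a then if y is Some b then a == b else true else true.

(** Tests a product equation on partial tables; [t1] acts first, as in the product of
    permutations. *)
Definition compat (t1 t2 t3 : seq (option nat)) :=
  all2 opt_eq [seq obind (nth None t2) x | x <- t1] t3.

Definition agree w v := compat (ball_table w) (ball_table [::]) (ball_table v).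

Definition dihedral_words c d : seq (seq 'I_3) :=
  [seq flatten (nseq a [:: c; d]) ++ nseq b c | a <- iota 0 12, b <- iota 0 2].

(** The parameter [k] enters only through the ends of the arms. For [k = 1] all arms continue beyond
    the ball, so the steps that depend on [k] leave it and are undefined in [lstep]. *)
Lemma step_ball k c a : c < 3 -> a < 13 -> tree_step 1 c a < 13 ->
  tree_step k c a = tree_step 1 c a.
Proof. by case: c => [|[|[|//]]] _; do 13?[case: a => [|a]]. Qed.

(* The product of the double transposition [(rho ty0 * rho ty1) ^+ 6] and of   *)
(* its conjugate by [rho ty2 * rho ty0 * rho ty2] is a 3-cycle; exchanging two *)
(* colours gives an element of order 2 instead.                                *)
Definition chiral_word : seq 'I_3 :=
  flatten (nseq 3 (flatten (nseq 6 [:: ty0; ty1]) ++ [:: ty2; ty0; ty2]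
                   ++ flatten (nseq 6 [:: ty0; ty1]) ++ [:: ty2; ty0; ty2])).

(** Search through all triples with [a * z = b], where [a] stands for the inverse of the first
    factor of [z]. The four words allowed are normal forms of the products of 1 or [rho ty2] with 1
    or [rho ty1]; the longest one is [rho ty1]. *)
Definition factor_check : bool :=
  let T c d := [seq (w, ball_table w) | w <- dihedral_words c d] in
  let Tz := T ty2 ty1 in let Ta := T ty2 ty0 in let Tb := T ty0 ty1 in
  all (fun z => all (fun a => all (fun b => compat a.2 z.2 b.2 ==>
    (z.1 \in [:: [::]; [:: ty2]; [:: ty2; ty1]; rcons (flatten (nseq 11 [:: ty2; ty1])) ty2]))
    Tb) Ta) Tz.

Lemma factor_check_true : factor_check.
Proof. by vm_compute. Qed.

(** As undefined entries count as agreement, success means that distinct words differ at a point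
    where both are defined. *)
Definition distinct_check c d : bool :=
  allrel (fun w v => agree w v ==> (w == v)) (dihedral_words c d) (dihedral_words c d).

Lemma all2_map (S T U : Type) (r : T -> U -> bool) (f : S -> T) (g : S -> U) s :
  all2 r (map f s) (map g s) = all (fun x => r (f x) (g x)) s.
Proof. by elim: s => //= x s ->. Qed.

Lemma mod9_split a : exists q r, r < 9 /\ a.+1 = 9 * q + r.
Proof. by exists (a.+1 %/ 9), (a.+1 %% 9); lia. Qed.

Lemma modn9_split q r : r < 9 -> (9 * q + r) %% 9 = r. Proof. lia. Qed.

(** * The generators as steps in the tree, and its rotation *)

Section Family.

Variable k : nat.

Local Notation n := (13 + 9 * k).
Local Notation pt := (pt k).
Local Notation par := (@parabolic k).
Local Notation step := (tree_step k).

Lemma val_pt a : 0 < a <= n -> pt a = a.-1 :> nat.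
Proof. by move=> Ha; rewrite /pt inordK //; lia. Qed.

Lemma val_transp a b (x : 'I_n) : 0 < a <= n -> 0 < b <= n ->
  transp k a b x = (if x == a.-1 :> nat then b.-1
                    else if x == b.-1 :> nat then a.-1 else x) :> nat.
Proof.
move=> Ha Hb; rewrite /transp; case: tpermP => [->|->|/eqP + /eqP];
  rewrite -?val_eqE /= ?val_pt ?eqxx //.
  by case: eqP.
by move=> /negPf-> /negPf->.
Qed.

(** The last transposition reaches the label [u + 9 * m - 6], whence the bound [n + 6]. *)
Lemma val_prod_transp u m (x : 'I_n) : 0 < u -> u + 9 * m <= n + 6 ->
  (\prod_(i < m) transp k (u + 9 * i) (3 + u + 9 * i)) x =
  (if (u <= x.+1 < u + 9 * m) && (x.+1 %% 9 == u %% 9) then x + 3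
   else if (3 + u <= x.+1 < 3 + u + 9 * m) && (x.+1 %% 9 == (3 + u) %% 9)
   then x - 3 else x) :> nat.
Proof.
move=> u0; elim: m => [|m IHm] Hm.
  by rewrite big_ord0 perm1; do !case: ifP => //; lia.
rewrite big_ord_recr /= permM val_transp ?IHm; try lia.
by do !case: ifP; lia.
Qed.

Definition rho (i : 'I_3) : 'S_n :=
  match val i with 0 => rho1 k | 1 => rho2 k | _ => rho3 k end.

Definition block_res u : seq nat := [:: u %% 9; (3 + u) %% 9].

Lemma prod_transp_res u m (x : 'I_n) : 0 < u -> u + 9 * m <= n + 6 ->
  let y := (\prod_(i < m) transp k (u + 9 * i) (3 + u + 9 * i)) x in
  if x.+1 %% 9 \in block_res u then y.+1 %% 9 \in block_res u else y == x.
Proof.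
move=> u0 Hm /=; rewrite !inE.
case: ifP => Hx; last rewrite -val_eqE; rewrite /= val_prod_transp //;
  by do 2?case: ifP; move: Hx; lia.
Qed.

(** Each block preserves its two residue classes of labels modulo 9 and fixes the other points. As
    the classes are disjoint, at most one block moves a given point. *)
Lemma prod3_transp u1 u2 u3 m (x : 'I_n) :
  all (fun u => (0 < u) && (u + 9 * m <= n + 6)) [:: u1; u2; u3] ->
  uniq (block_res u1 ++ block_res u2 ++ block_res u3) ->
  let B u := \prod_(i < m) transp k (u + 9 * i) (3 + u + 9 * i) in
  (B u1 * B u2 * B u3) x =
    if x.+1 %% 9 \in block_res u1 then B u1 x
    else if x.+1 %% 9 \in block_res u2 then B u2 x else B u3 x.
Proof.
case/and4P=> /andP[p1 H1] /andP[p2 H2] /andP[p3 H3] _.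
rewrite cat_uniq => /and3P[_ /hasPn D1 /[!cat_uniq]/and3P[_ /hasPn D2 _]].
move=> B; rewrite !permM {}/B.
have R1 := prod_transp_res x p1 H1.
have R2 y := prod_transp_res y p2 H2; have R3 y := prod_transp_res y p3 H3.
case: ifP R1 => r1 /= R1.
  set y := fun_of_perm _ x in R1 *.
  have /= := R2 y; case: ifP => [r2|_ /eqP->].
    by have := D1 (y.+1 %% 9); rewrite mem_cat r2 /= R1 => /(_ isT).
  have /= := R3 y; case: ifP => [r3|_ /eqP-> //].
  by have := D1 (y.+1 %% 9); rewrite mem_cat r3 orbT /= R1 => /(_ isT).
rewrite (eqP R1); have /= := R2 x; case: ifP => r2 /=; last by move/eqP->.
set y := fun_of_perm _ x => {}R2.
have /= := R3 y; case: ifP => [r3|_ /eqP-> //].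
by have := D2 _ r3; rewrite /= R2.
Qed.

Local Notation rword := (word rho).

Lemma rho_val i x : rho i x = step i x :> nat.
Proof.
case: i => [[|[|[|//]]] p]; rewrite /rho /tree_step /= /rho1 /rho2 /rho3.
1: rewrite -2!mulgA (mulgA (\prod_(i < _) _)) permM
  (@prod3_transp 8 3 7 k.+1) //=; try lia.
2: rewrite -2!mulgA (mulgA (\prod_(i < _) _)) permM
  (@prod3_transp 5 9 4 k.+1) //=; try lia.
3: rewrite -2!mulgA (mulgA (\prod_(i < _) _)) permM
  (@prod3_transp 2 6 10 k.+1) //=; try lia.
1: move: (@val_transp 1 2 x isT isT).
2: move: (@val_transp 1 3 x isT isT).
3: move: (@val_transp 1 4 x isT isT).
all: move: (fun_of_perm _ _) => x1 F1.
all: rewrite !(fun_if (@nat_of_ord _)) !val_prod_transp //; try lia.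
all: move: (ltn_ord x) F1; move: (x : nat) (x1 : nat) => {p x x1} x x1 Hx.
all: have [_ -> //|x0] := eqVneq x 0.
1: have [_ -> //|x1' ->] := eqVneq x 1%N.
2: have [_ -> //|x1' ->] := eqVneq x 2.
3: have [_ -> //|x1' ->] := eqVneq x 3.
all: have [q [r [r9 Er]]] := mod9_split x; rewrite Er !modn9_split // /block_res.
all: move/eqP: x0 => x0; move/eqP: x1' => x1'.
all: by do 9?[case: r Er r9 => [|r] Er r9]; rewrite /= ?inE /=; do ?case: ifP; lia.
Qed.

(* The arms are the residue classes modulo 3 of the points other than 0. *)
Definition turn a : nat :=
  if a == 0 then 0 else if a %% 3 == 0 then a - 2 else a + 1.

Lemma turn_lt a : a < n -> turn a < n.
Proof. by rewrite /turn; do !case: ifP; lia. Qed.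

Lemma turnK a : turn (turn (turn a)) = a.
Proof.
have [q [r [r3 ->]]] : exists q r, r < 3 /\ a = 3 * q + r.
  by exists (a %/ 3), (a %% 3); lia.
by rewrite /turn; case: r r3 => [|[|[|//]]] _; do !case: ifP; lia.
Qed.

Definition tau_fun (x : 'I_n) : 'I_n := Ordinal (turn_lt (ltn_ord x)).

Lemma tau_inj : injective tau_fun.
Proof.
move=> x y [E]; apply: val_inj; rewrite /= -(turnK x) -(turnK y).
by congr (turn (turn _)).
Qed.

Definition tau : 'S_n := perm tau_inj.

(** The edge from [a] outward to [a + 3]; the condition [0 < a] leaves out the edges at the
    centre. *)
Definition edge c a := [&& 0 < a, a.+1 %% 9 \in up_res c & a + 3 < n].

Lemma step_edge c a : c < 3 -> edge c a -> step c a = a + 3 /\ step c (a + 3) = a.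
Proof.
case: c => [|[|[|//]]] _; rewrite /edge /tree_step /= !inE => H.
all: by split; do !case: ifP; lia.
Qed.

Lemma step_cases c a : c < 3 -> a < n ->
  a = 0 \/ a = c.+1 \/ step c a = a \/ edge c a \/ 3 < a /\ edge c (a - 3).
Proof.
move=> c3 Ha; rewrite /tree_step /edge; case: eqP => a0; first by left.
case: eqP => ac; first by right; left.
case: ifP => H1; first by do 3!right; left; rewrite lt0n; apply/andP; split; [exact/eqP|].
case: ifP => [/andP[H2 a3]|_]; last by do 2!right; left.
do 4!right; split=> //; rewrite subnK ?(ltnW a3) // Ha andbT subn_gt0 a3 /=.
by case: c c3 H2 {H1 ac} => [|[|[|//]]] _; rewrite /= !inE; lia.
Qed.

Lemma step_fixed c a : c < 3 -> 0 < a < n -> a != c.+1 -> ~~ edge c a ->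
  ~~ ((3 < a) && edge c (a - 3)) -> step c a = a.
Proof.
move=> c3 /andP[a0 Ha] ac nE nE'.
have [E|[E|[//|[E|[E E']]]]] := step_cases c3 Ha.
- by rewrite E in a0.
- by rewrite E eqxx in ac.
- by rewrite E in nE.
by rewrite E E' in nE'.
Qed.

(** [turn] preserves the distance from the centre and the arms are equally long, which settles the
    bound. Labels grow by 1 or drop by 2, that is, by +7 modulo 9, and this carries [up_res] of one
    colour to that of the next. *)
Lemma edge_turn c a : c < 3 -> 0 < a < n -> edge (c.+1 %% 3) (turn a) = edge c a.
Proof.
move=> c3 /andP[a0 Ha]; have [q [r [r9 Er]]] := mod9_split a.
have {}Er : a = 9 * q + r - 1 by lia.
have turnE : turn a = if r %% 3 == 1%N then a - 2 else a + 1.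
  by rewrite /turn ifF; [do 2!case: ifP; lia | lia].
have resE : (turn a).+1 %% 9 = if r %% 3 == 1%N then (r + 7) %% 9 else r.+1 %% 9.
  by rewrite turnE; case: ifP; lia.
rewrite /edge resE; have -> : a.+1 %% 9 = r by lia.
have -> : 0 < turn a by rewrite turnE; case: ifP; lia.
have -> : (turn a + 3 < n) = (a + 3 < n) by rewrite turnE; case: ifP; lia.
rewrite a0; congr (_ && (_ && _)).
by case: c c3 => [|[|[|//]]] _; move: r r9 {Er turnE resE}; do 9?[case=> [//|]].
Qed.

Lemma rho_tau i : rho i ^ tau = rho (ordS i).
Proof.
apply/permP=> y; rewrite -(permKV tau y); move: (tau^-1 y) => {y} x.
rewrite permJ; apply: val_inj; rewrite !permE /= !rho_val.
have /= := ltn_ord x; move: (x : nat) => {x} a Ha.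
case: i => [c c3] /=; have c3' : c.+1 %% 3 < 3 by rewrite ltn_mod.
have turn3 b : 0 < b -> turn (b + 3) = turn b + 3.
  by move=> b0; rewrite /turn; do !case: ifP; lia.
have turn_gt0 b : 0 < b -> 0 < turn b by rewrite /turn; do !case: ifP; lia.
have step0 d : step d 0 = d.+1 by [].
have stepS d : step d d.+1 = 0 by rewrite /tree_step /= eqxx.
have turn0 : turn 0 = 0 by [].
have turnc : turn c.+1 = (c.+1 %% 3).+1 by case: c c3 {c3'} => [|[|[|//]]].
have [->|a0] := posnP a; first by rewrite turn0 !step0.
have [->|ac] := eqVneq a c.+1; first by rewrite turnc !stepS.
case: (boolP (edge c a)) => [E|nE].
  have E' : edge (c.+1 %% 3) (turn a) by rewrite edge_turn ?a0.
  by rewrite (step_edge c3 E).1 (step_edge c3' E').1 turn3.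
case: (boolP ((3 < a) && edge c (a - 3))) => [/andP[a3 E]|nE'].
  have E' : edge (c.+1 %% 3) (turn (a - 3)) by rewrite edge_turn //; lia.
  have defa : a = a - 3 + 3 by lia.
  rewrite defa (step_edge c3 E).2 turn3; last by lia.
  by rewrite (step_edge c3' E').2.
rewrite step_fixed ?a0 //; apply/esym/step_fixed; rewrite ?turn_gt0 ?turn_lt //.
- by apply: contra ac => /eqP E; rewrite -(turnK a) E -turnc turnK.
- by rewrite edge_turn ?a0.
apply: contra nE' => /andP[a3' E].
have a3 : 3 < a by move: a3'; rewrite /turn; do !case: ifP; lia.
rewrite a3 -edge_turn //; last by lia.
suff -> : turn (a - 3) = turn a - 3 by [].
by rewrite -[in RHS](subnK (ltnW a3)) turn3 ?addnK; lia.
Qed.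

Lemma rhoK i : rho i * rho i = 1.
Proof.
apply/permP=> x; rewrite permM perm1; apply: val_inj; rewrite /= !rho_val.
have [->|[->|[E|[H|[a3 H]]]]] := step_cases (ltn_ord i) (ltn_ord x).
- by rewrite /tree_step /= eqxx.
- by rewrite /tree_step /= eqxx.
- by rewrite !E.
- by have [E1 E2] := step_edge (ltn_ord i) H; rewrite E1 E2.
have [E1 E2] := step_edge (ltn_ord i) H.
by rewrite subnK ?(ltnW a3) // in E1 E2; rewrite E2 E1.
Qed.

(* Off the centre and off the ends of two arms, a component of the subgraph of *)
(* colours 0 and 1 is a path [a - a+3 - a+6] with edges coloured 1 and 0.      *)
Definition path3 a :=
  [/\ step 0 a = a, step 1 a = a + 3 & step 1 (a + 3) = a] /\
  [/\ step 0 (a + 3) = a + 6, step 0 (a + 6) = a + 3 & step 1 (a + 6) = a + 6].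

Lemma path3_intro a : 2 < a -> a.+1 %% 9 \in [:: 0; 4; 5] -> a + 6 < n -> path3 a.
Proof.
rewrite !inE => a2 Ha Han.
by do 2!split; rewrite /tree_step /= !inE; do !case: ifP; lia.
Qed.

Definition step01 a := step 1 (step 0 a).

(** On a path with three vertices the product of the two colours is a 3-cycle. *)
Lemma path3_iter a : path3 a ->
  [/\ iter 6 step01 a = a, iter 6 step01 (a + 3) = a + 3 & iter 6 step01 (a + 6) = a + 6].
Proof.
case=> [[E1 E2 E3] [E4 E5 E6]].
by rewrite /= /step01; split; rewrite ?(E1, E2, E3, E4, E5, E6).
Qed.

(** Apart from the path 1 - 0 - 2 - 5 through the centre, the components of colours 0 and 1 have at
    most three vertices, so the product of the colours has order 1, 2 or 3 on each. *)
Lemma iter_off_centre a : a < n -> a \notin [:: 0; 1%N; 2; 5] -> iter 6 step01 a = a.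
Proof.
rewrite !inE !negb_or => Ha /and4P[/eqP a0 /eqP a1 /eqP a2 /eqP a5].
have P b : 2 < b -> b.+1 %% 9 \in [:: 0; 4; 5] -> b + 6 < n ->
    a = b \/ a = b + 3 \/ a = b + 6 -> iter 6 step01 a = a.
  move=> b2 Rb Hb; have /path3_iter[E1 E2 E3] := path3_intro b2 Rb Hb.
  by case=> [->|[->|->]].
(* At the ends of the arms two paths are truncated, to two vertices and to a single one. *)
have Q : a = 8 + 9 * k \/ a = 11 + 9 * k \/ a = 12 + 9 * k -> iter 6 step01 a = a.
  have E1 b : b \in [:: 8; 11; 12] -> step 0 (b + 9 * k) = b + 9 * k.
    by rewrite /tree_step /= !inE; do !case: ifP; lia.
  have E2 : step 1 (8 + 9 * k) = 11 + 9 * k.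
    by rewrite /tree_step /= !inE; do !case: ifP; lia.
  have E3 : step 1 (11 + 9 * k) = 8 + 9 * k.
    by rewrite /tree_step /= !inE; do !case: ifP; lia.
  have E4 : step 1 (12 + 9 * k) = 12 + 9 * k.
    by rewrite /tree_step /= !inE; do !case: ifP; lia.
  by case=> [->|[]->]; rewrite /= /step01 ?(E1, E2, E3, E4) //.
have [q [r [r9 Er]]] := mod9_split a.
have C : r \in [:: 0; 4; 5] \/ r \in [:: 3; 7; 8] \/ r \in [:: 1%N; 2; 6].
  by rewrite !inE; lia.
have [Ha6|Ha6] := ltnP (a + 6) n; rewrite !inE in C.
  case: C => [C|[C|C]].
  - by apply: (P a); rewrite ?inE; lia.
  - by apply: (P (a - 3)); rewrite ?inE; lia.
  by apply: (P (a - 6)); rewrite ?inE; lia.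
case: C => [C|[C|C]].
- by apply: Q; lia.
- have [|] := eqVneq a (11 + 9 * k); first by move=> E; apply: Q; lia.
  by move=> ?; apply: (P (a - 3)); rewrite ?inE; lia.
by apply: (P (a - 6)); rewrite ?inE; lia.
Qed.

(** * Computation in the ball, uniformly in [k] *)

Definition ballpt a := pt a.+1.

Lemma val_ballpt a : a < 13 -> ballpt a = a :> nat.
Proof. by move=> Ha; rewrite val_pt //=; lia. Qed.

Lemma run_word w a b : a < 13 -> run w a = Some b ->
  b < 13 /\ rword w (ballpt a) = ballpt b.
Proof.
elim: w a => [|c w IHw] a Ha /=; first by case=> <-; rewrite /word big_nil perm1.
rewrite /lstep; case: ifP => //= Hs /(IHw _ Hs)[Hb Eb]; split=> //.
rewrite /word big_cons permM -Eb; congr (fun_of_perm _ _).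
by apply: val_inj; rewrite /= rho_val !val_ballpt // step_ball //.
Qed.

(** The tables are partial, so a computation in the ball can refute an equation between words but
    cannot by itself prove one. *)
Lemma compat_word u v w : rword u * rword v = rword w ->
  compat (ball_table u) (ball_table v) (ball_table w).
Proof.
move=> E; rewrite /compat -map_comp all2_map; apply/allP=> a.
rewrite mem_iota /= => Ha.
case Eu: (run u a) => [b|] //=; have [Hb Eb] := run_word Ha Eu.
rewrite (nth_map 0) ?size_iota // nth_iota // add0n.
case Ev: (run v b) => [c|] //=; have [Hc Ec] := run_word Hb Ev.
case Ew: (run w a) => [d|] //=; have [Hd Ed] := run_word Ha Ew.
by rewrite -(val_ballpt Hc) -(val_ballpt Hd) -Ed -E permM Eb Ec.
Qed.

Lemma ballptK (x : 'I_n) : ballpt x = x.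
Proof. exact: inord_val. Qed.

Lemma ballpt_eq a b : a < 13 -> b < 13 -> (ballpt a == ballpt b) = (a == b).
Proof. by move=> Ha Hb; rewrite -val_eqE /= !val_ballpt. Qed.

Lemma ballpt_tau a : a < 13 -> tau (ballpt a) = ballpt (turn a).
Proof.
move=> Ha; apply: val_inj; rewrite permE /= val_ballpt // val_ballpt //.
by rewrite /turn; do !case: ifP; lia.
Qed.

Definition tperms (ts : seq (nat * nat)) : 'S_n :=
  \prod_(t <- ts) tperm (ballpt t.1) (ballpt t.2).

Definition swaps (ts : seq (nat * nat)) a :=
  foldl (fun x t => if x == t.1 then t.2 else if x == t.2 then t.1 else x) a ts.

Definition in_ball (ts : seq (nat * nat)) := all (fun t => (t.1 < 13) && (t.2 < 13)) ts.

Definition points (ts : seq (nat * nat)) := flatten [seq [:: t.1; t.2] | t <- ts].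

Lemma tperms_ballpt ts a : in_ball ts -> a < 13 ->
  tperms ts (ballpt a) = ballpt (swaps ts a).
Proof.
rewrite /tperms; elim: ts a => [|t ts IHts] a /=; first by rewrite big_nil perm1.
case/andP=> /andP[H1 H2] Hts Ha; rewrite big_cons permM -IHts //; last by do !case: ifP.
congr (fun_of_perm _ _); rewrite -!(ballpt_eq Ha) //.
case: tpermP => [->|->|/eqP/negPf-> /eqP/negPf-> //]; rewrite eqxx //.
by case: eqP => // ->.
Qed.

Lemma tperms_id ts (x : 'I_n) : in_ball ts -> (x : nat) \notin points ts -> tperms ts x = x.
Proof.
rewrite /tperms; elim: ts => [|t ts IHts] /=; first by rewrite big_nil perm1.
case/andP=> /andP[H1 H2] Hts; rewrite !inE !negb_or => /and3P[n1 n2 nts].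
rewrite big_cons permM tpermD ?IHts //.
  by apply: contraNneq n1 => <-; rewrite val_ballpt.
by apply: contraNneq n2 => <-; rewrite val_ballpt.
Qed.

Lemma eq_ballP (s t : 'S_n) (L : seq nat) :
  (forall x : 'I_n, (x : nat) \notin L -> s x = t x) ->
  (forall a, a \in L -> a < 13 -> s (ballpt a) = t (ballpt a)) ->
  all (fun a => a < 13) L -> s = t.
Proof.
move=> off on /allP HL; apply/permP=> x.
case: (boolP ((x : nat) \in L)) => [Lx|/off //].
by rewrite -(ballptK x) on // HL.
Qed.

Lemma points_in_ball ts : in_ball ts -> all (fun a => a < 13) (points ts).
Proof. by elim: ts => //= t ts IHts /andP[/andP[-> ->] /IHts]. Qed.

(** Reduces an equation in the symmetric group to finitely many points of the ball, independently of
    [k]. *)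
Lemma eq_tperms ts us : in_ball ts -> in_ball us ->
  all (fun a => swaps ts a == swaps us a) (points ts ++ points us) ->
  tperms ts = tperms us.
Proof.
move=> Bt Bu /allP E; apply: (@eq_ballP _ _ (points ts ++ points us)).
- move=> x; rewrite mem_cat negb_or => /andP[nt nu].
  by rewrite !tperms_id.
- by move=> a La Ha; rewrite !tperms_ballpt // (eqP (E _ La)).
by rewrite all_cat !points_in_ball.
Qed.

Lemma tperms_cat ts us : tperms (ts ++ us) = tperms ts * tperms us.
Proof. exact: big_cat. Qed.

Lemma tpermsJ ts (s : 'S_n) (f : nat -> nat) :
  {in points ts, forall a, s (ballpt a) = ballpt (f a)} ->
  tperms ts ^ s = tperms [seq (f t.1, f t.2) | t <- ts].
Proof.
rewrite /tperms; elim: ts => [|t ts IHts] E; first by rewrite !big_nil conj1g.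
rewrite /= !big_cons conjMg tpermJ !E ?inE ?eqxx ?orbT //; congr (_ * _).
by apply: IHts => a La; apply: E; rewrite !inE La !orbT.
Qed.

Lemma tpermsJ_word ts u : all (fun a => (a < 13) && isSome (run u a)) (points ts) ->
  tperms ts ^ rword u
    = tperms [seq (odflt 0 (run u t.1), odflt 0 (run u t.2)) | t <- ts].
Proof.
move/allP=> H; apply: (tpermsJ (f := fun a => odflt 0 (run u a))) => a /H /andP[Ha].
by case E: (run u a) => [b|] // _; have [] := run_word Ha E.
Qed.

Lemma rho01_val m (x : 'I_n) :
  ((rho ty0 * rho ty1) ^+ m) x = iter m step01 x :> nat.
Proof.
elim: m => [|m IHm]; first by rewrite perm1.
by rewrite expgSr permM permM !rho_val IHm.
Qed.

(** On the path 1 - 0 - 2 - 5 the product is a 4-cycle, whose sixth power is its square;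
    [iter_off_centre] deals with the other points. *)
Lemma rho01_pow6 : (rho ty0 * rho ty1) ^+ 6 = tperms [:: (1%N, 5); (0, 2)].
Proof.
apply: (@eq_ballP _ _ [:: 0; 1%N; 2; 5]) => // [x off | a La Ha].
  rewrite tperms_id //; last first.
    by move: off; rewrite /points !inE /= !negb_or => /and4P[-> -> -> ->].
  by apply: val_inj; rewrite /= rho01_val iter_off_centre.
rewrite tperms_ballpt //.
have -> : (rho ty0 * rho ty1) ^+ 6 = rword (flatten (nseq 6 [:: ty0; ty1])).
  by rewrite word_nseq /word !big_cons big_nil mulg1.
have : run (flatten (nseq 6 [:: ty0; ty1])) a = Some (swaps [:: (1%N, 5); (0, 2)] a).
  by move: La; rewrite !inE => /or4P[] /eqP->; vm_compute.
by case/(run_word Ha).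
Qed.

Lemma rho01_pow12 : (rho ty0 * rho ty1) ^+ 12 = 1.
Proof.
rewrite (expgM _ 6 2) rho01_pow6 expgS expg1 -tperms_cat.
have -> : 1 = tperms [::] by rewrite /tperms big_nil.
by apply: eq_tperms; vm_compute.
Qed.

Lemma rho_pow12 i j : i != j -> (rho i * rho j) ^+ 12 = 1.
Proof.
have E12 : (rho ty1 * rho ty2) ^+ 12 = 1.
  by have := rho01_pow12; move/(congr1 (conjg^~ tau));
    rewrite conjXg conjMg !rho_tau !ordS_ty conj1g.
have E20 : (rho ty2 * rho ty0) ^+ 12 = 1.
  by have := E12; move/(congr1 (conjg^~ tau));
    rewrite conjXg conjMg !rho_tau !ordS_ty conj1g.
have inv u v : (rho u * rho v) ^+ 12 = 1 -> (rho v * rho u) ^+ 12 = 1.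
  have V w : (rho w)^-1 = rho w by apply: (mulgI (rho w)); rewrite mulgV rhoK.
  by move/(congr1 invg); rewrite -expgVn invMg !V invg1.
have := rho01_pow12.
by case: (ord3P i) => ->; case: (ord3P j) => -> //; auto.
Qed.

Lemma word_chiral : rword chiral_word = 1.
Proof.
have E6 : rword (flatten (nseq 6 [:: ty0; ty1])) = tperms [:: (1%N, 5); (0, 2)].
  by rewrite word_nseq /word !big_cons big_nil mulg1 rho01_pow6.
rewrite /chiral_word word_nseq; set t := flatten _ in E6 *; set u := [:: ty2; ty0; ty2].
rewrite (word_cat rho t) (word_cat rho u) (word_cat rho t) E6.
(* [u] is a palindrome, so [rword u] is its own inverse and each block of the word is the double
   transposition times its conjugate. The two share (1 5), which cancels, and (0 2)(0 8) has order
   3. *)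
have Vu : rword u = (rword u)^-1 by rewrite -(word_rev rhoK).
have E : tperms [:: (1%N, 5); (0, 2)] ^ rword u = tperms [:: (1%N, 5); (0, 8)].
  by rewrite tpermsJ_word.
rewrite {1}Vu -conjgE E expgS expgS expg1 -!tperms_cat.
have -> : 1 = tperms [::] by rewrite /tperms big_nil.
by apply: eq_tperms; vm_compute.
Qed.

(** * Alternating groups *)

Lemma rho_GG i : rho i \in GG k.
Proof. by apply: mem_gen; case: (ord3P i) => ->; rewrite !inE eqxx ?orbT. Qed.

Lemma GG_tau : GG k :^ tau = GG k.
Proof.
have E : [set rho1 k; rho2 k; rho3 k] = [set rho ty0; rho ty1; rho ty2] by [].
rewrite /= E -genJ !conjUg !conjg_set1 !rho_tau !ordS_ty; congr <<_>>.
by rewrite setUC setUA.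
Qed.

Lemma memJ_GG_tau x : (x ^ tau \in GG k) = (x \in GG k).
Proof. by rewrite -{1}GG_tau memJ_conjg. Qed.

Definition star a := tperm (ballpt 0) (ballpt a).

Lemma star_pairs i j : star (i : 'I_3).+1 * star (j : 'I_3).+1 \in GG k.
Proof.
have t01 : (rho ty0 * rho ty1) ^+ 6 \in GG k by apply/groupX/groupM; apply: rho_GG.
have E31 : star 3 * star 1 \in GG k.
  have t12 : tperms [:: (2, 6); (0, 3)] \in GG k.
    move: t01; rewrite rho01_pow6 -memJ_GG_tau (tpermsJ (f := turn)) //.
    by move=> a; rewrite !inE => /or4P[] /eqP->; rewrite ballpt_tau.
  have := groupJ t12 (rho_GG ty0).
  have -> : rho ty0 = rword [:: ty0] by rewrite /word big_seq1.
  rewrite tpermsJ_word //= => t12J.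
  (* The two double transpositions share only the point 3. Squaring their product removes (2 6) and
     (5 9) and leaves a 3-cycle on 0, 1, 3. *)
  have : (tperms [:: (2, 6); (0, 3)] * tperms [:: (5, 9); (1%N, 3)]) ^+ 2 \in GG k.
    by rewrite groupX ?groupM.
  rewrite expgS expg1 -!tperms_cat.
  have -> : tperms (([:: (2, 6); (0, 3)] ++ [:: (5, 9); (1%N, 3)])
                  ++ [:: (2, 6); (0, 3)] ++ [:: (5, 9); (1%N, 3)])
          = tperms [:: (0, 3); (0, 1%N)] by apply: eq_tperms; vm_compute.
  by rewrite /tperms !big_cons big_nil mulg1.
have starJ a b : a < 13 -> b < 13 -> star a * star b \in GG k ->
    star (turn a) * star (turn b) \in GG k.
  by move=> Ha Hb; rewrite -memJ_GG_tau conjMg !tpermJ !ballpt_tau.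
have E12 := starJ 3 1%N isT isT E31; have E23 := starJ 1%N 2 isT isT E12.
have starV a b : star a * star b \in GG k -> star b * star a \in GG k.
  by rewrite -groupV invMg !tpermV.
have star1 a : star a * star a \in GG k by rewrite tperm2 group1.
by case: (ord3P i) => ->; case: (ord3P j) => ->; auto.
Qed.

Lemma star_in_GG (x : 'I_n) : x != ballpt 0 ->
  star 1 * tperm (ballpt 0) x \in GG k.
Proof.
have [m] := ubnP (x : nat); elim: m x => // m IHm x /ltnSE-Hm.
rewrite -val_eqE /= val_ballpt // => x0.
have [x4|x3] := ltnP 3 x; last first.
  have Hx : (x : nat).-1 < 3 by lia.
  have := star_pairs ty0 (Ordinal Hx).
  by rewrite /star /= prednK ?lt0n // ballptK.
have [c Hc] : exists c : 'I_3, edge c (x - 3).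
  have Hx : 0 < x - 3 by lia.
  have Hn : x - 3 + 3 < n by rewrite subnK ?(ltnW x4).
  have := ltn_pmod (x - 3).+1 (isT : 0 < 9).
  rewrite /edge Hx Hn; move: (_ %% 9) => [|[|[|[|[|[|[|[|[|//]]]]]]]]] _;
    first [by exists ty0 | by exists ty1 | by exists ty2].
have Hy : x - 3 < n by apply: leq_ltn_trans (ltn_ord x); apply: leq_subr.
pose y := Ordinal Hy.
have cy : rho c y = x.
  apply: val_inj; rewrite /= rho_val (step_edge (ltn_ord c) Hc).1.
  by rewrite subnK // ltnW.
have Hc13 : c.+1 < 13 by have := ltn_ord c; lia.
have cc : rho c (ballpt c.+1) = ballpt 0.
  by apply: val_inj; rewrite /= rho_val !val_ballpt // /tree_step /= eqxx.
have c0 : rho c (ballpt 0) = ballpt c.+1.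
  by apply: val_inj; rewrite /= rho_val !val_ballpt.
have y0 : y != ballpt 0 by rewrite -val_eqE /= val_ballpt //; lia.
have Gy : star c.+1 * tperm (ballpt 0) y \in GG k.
  have -> : star c.+1 * tperm (ballpt 0) y
          = star c.+1 * star 1 * (star 1 * tperm (ballpt 0) y).
    by rewrite !mulgA -(mulgA (star c.+1)) tperm2 mulg1.
  rewrite groupM ?(star_pairs c ty0) //; apply: IHm => //=; lia.
have Gx : tperm (ballpt 0) x * star c.+1 \in GG k.
  have := groupJ Gy (rho_GG c); rewrite conjMg !tpermJ cc cy c0.
  (* Conjugation by [rho c] exchanges the centre with [c.+1] and moves [y] out to [x]; the result (0
     c+1)(c+1 x) equals (0 x)(0 c+1). *)
  suff -> : tperm (ballpt c.+1) x = tperm (ballpt 0) x ^ star c.+1.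
    by rewrite tpermC conjgE tpermV !mulgA tperm2 mul1g.
  rewrite tpermJ tpermL tpermD // -val_eqE /= val_ballpt //.
    by rewrite eq_sym.
  by rewrite neq_ltn; apply/orP; left; have := ltn_ord c; lia.
have -> : star 1 * tperm (ballpt 0) x
        = star 1 * star c.+1 * (star c.+1 * tperm (ballpt 0) x).
  by rewrite !mulgA -(mulgA (star 1)) tperm2 mulg1.
rewrite groupM ?(star_pairs ty0 c) // -groupV invMg !tpermV //.
Qed.

(** The transpositions (0 y) generate the symmetric group. Multiplying by [star 1] whenever the
    parity is odd splits any such product into pairs that [star_in_GG] puts into [GG k]. *)
Lemma Alt_sub_GG : 'Alt_('I_n) \subset GG k.
Proof.
suff odd_fix s : s \in [set: {perm 'I_n}] -> s * star 1 ^+ odd_perm s \in GG k.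
  apply/subsetP=> s; rewrite Alt_even => /negPf even_s.
  by have := odd_fix s (in_setT s); rewrite even_s mulg1.
rewrite -(gen_tperm (ballpt 0)); elim/gen_mulr_ind: s / => [|s _ _ /imsetP[y _ ->] IHs].
  by rewrite odd_perm1 mulg1 group1.
have [->|y0] := eqVneq y (ballpt 0); first by rewrite tperm1 mulg1.
have Gy := star_in_GG y0.
rewrite odd_permM odd_tperm eq_sym y0 addbT.
case: (odd_perm s) IHs => IHs; last first.
  have Gs : s \in GG k by rewrite -[s]mulg1.
  have {}Gy : tperm (ballpt 0) y * star 1 \in GG k by rewrite -groupV invMg !tpermV.
  by rewrite -[_ ^+ _]/(star 1) -mulgA groupM.
rewrite -[_ ^+ _]/1 mulg1.
have -> : s * tperm (ballpt 0) y = s * star 1 * (star 1 * tperm (ballpt 0) y).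
  by rewrite !mulgA -(mulgA s) tperm2 mulg1.
exact: groupM.
Qed.

Lemma odd_prod_transp u m : 0 < u -> u + 9 * m <= n + 6 ->
  odd_perm (\prod_(i < m) transp k (u + 9 * i) (3 + u + 9 * i)) = odd m.
Proof.
move=> u0; elim: m => [|m IHm] Hm; first by rewrite big_ord0 odd_perm1.
rewrite big_ord_recr odd_permM IHm /=; last by lia.
by rewrite odd_tperm -val_eqE /= !val_pt; lia.
Qed.

(** Each generator is a product of [1 + 3 * k.+1] transpositions. *)
Lemma odd_rho i : odd_perm (rho i) = odd k.
Proof.
have T b : 1 < b < 5 -> odd_perm (transp k 1 b).
  by move=> Hb; rewrite odd_tperm -val_eqE /= !val_pt; lia.
case: (ord3P i) => ->; rewrite /rho /= /rho1 /rho2 /rho3 !odd_permM.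
- by rewrite T // (@odd_prod_transp 8) ?(@odd_prod_transp 3)
    ?(@odd_prod_transp 7) //; lia.
- by rewrite T // (@odd_prod_transp 5) ?(@odd_prod_transp 9)
    ?(@odd_prod_transp 4) //; lia.
- by rewrite T // (@odd_prod_transp 2) ?(@odd_prod_transp 6)
    ?(@odd_prod_transp 10) //; lia.
Qed.

Lemma GG_even : ~~ odd k -> GG k :=: 'Alt_('I_n).
Proof.
move=> evk; apply/eqP; rewrite eqEsubset Alt_sub_GG andbT gen_subG.
apply/subsetP=> s Hs; rewrite Alt_even.
have [i ->] : exists i, s = rho i.
  by case/setUP: Hs => [/set2P[]|/set1P]->; [exists ty0 | exists ty1 | exists ty2].
by rewrite odd_rho.
Qed.

Lemma GG_odd : odd k -> GG k :=: 'Sym_('I_n).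
Proof.
move=> odk; apply/eqP; rewrite eqEsubset subsetT; apply/subsetP=> s _.
have [es|os] := boolP (odd_perm s); last by rewrite (subsetP Alt_sub_GG) // Alt_even.
rewrite -(mulgK (rho ty0) s) groupM ?groupV ?rho_GG //.
by rewrite (subsetP Alt_sub_GG) // Alt_even odd_permM es odd_rho odk.
Qed.

(** * Parabolic subgroups *)

Lemma agree_word w v : rword w = rword v -> agree w v.
Proof. by move=> E; apply: compat_word; rewrite /word big_nil mulg1 -/(word _ w) E. Qed.

Lemma parabolicE i : par i = <<[set rho j | j in ~: [set i]]>> :> {set 'S_n}.
Proof. by case: (ord3P i) => ->; rewrite !setC_ty imsetU1 imset_set1. Qed.

Lemma GGE : GG k = <<[set rho j | j in [set: 'I_3]]>> :> {set 'S_n}.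
Proof.
congr <<_>>; apply/setP=> x; apply/idP/imsetP=> [|[j _ ->]].
  by case/setUP=> [/set2P[]|/set1P]->; [exists ty0 | exists ty1 | exists ty2].
by case: (ord3P j) => ->; rewrite !inE eqxx ?orbT.
Qed.

Lemma rho_parabolic i j : i != j -> rho i \in par j.
Proof. by move=> neq; rewrite parabolicE mem_gen // imset_f // !inE. Qed.

Lemma parabolic_sub i : par i \subset GG k.
Proof. by rewrite parabolicE GGE genS // imsetS // subsetT. Qed.

Lemma parabolic_tau i : par i :^ tau = par (ordS i).
Proof.
rewrite !parabolicE -genJ; congr <<_>>.
by case: (ord3P i) => ->; rewrite ?ordS_ty !setC_ty !imsetU1 !imset_set1 conjUg
  !conjg_set1 !rho_tau !ordS_ty // setUC.
Qed.

Lemma mem_parabolic_tau i x : (x ^ tau \in par (ordS i)) = (x \in par i).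
Proof. by rewrite -parabolic_tau memJ_conjg. Qed.

Lemma mem_dihedral c d x : c != d -> x \in <<[set rho c; rho d]>> ->
  exists2 w, w \in dihedral_words c d & x = rword w.
Proof.
move=> neq /(gen_involutions (isT : 0 < 12) (rhoK c) (rhoK d) (rho_pow12 neq)).
case=> a [b [a12 ->]]; exists (flatten (nseq a [:: c; d]) ++ nseq b c).
  by apply/allpairsP; exists (a, nat_of_bool b); rewrite !mem_iota; split=> //; case: b.
by rewrite word_dihedral.
Qed.

Lemma word_dihedral_words c d w :
  w \in dihedral_words c d -> rword w \in <<[set rho c; rho d]>>.
Proof.
case/allpairsP=> [[a b] /= [_ Hb ->]].
have -> : b = (b == 1%N) :> nat by case: b Hb => [|[|]].
by rewrite word_dihedral groupM ?groupX ?groupM ?mem_gen ?set21 ?set22.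
Qed.

Lemma card_dihedral c d : c != d -> distinct_check c d -> #|<<[set rho c; rho d]>>| = 24.
Proof.
move=> neq /allrelP chk.
have E : <<[set rho c; rho d]>> =i [seq rword w | w <- dihedral_words c d].
  move=> x; apply/idP/mapP=> [/(mem_dihedral neq)//|[w Ww ->]].
  exact: word_dihedral_words.
rewrite (eq_card E) (card_uniqP _) ?size_map ?size_allpairs ?size_iota //.
rewrite map_inj_in_uniq; last first.
  by move=> w v Ww Wv /agree_word A; apply/eqP; have := chk w v Ww Wv; rewrite A.
(* For [b] below 2 the length [2 * a + b] determines both parameters, so the list of words has no
   repetition. *)
have inj a b : size (flatten (nseq a [:: c; d]) ++ nseq b c) = 2 * a + b.
  by rewrite size_cat size_nseq size_flatten /shape map_nseq sumn_nseq.
apply: allpairs_uniq; rewrite ?iota_uniq // => -[a b] [a' b'].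
move=> /allpairsP[[x y] [_ Hy E1]] /allpairsP[[x' y'] [_ Hy' E2]].
case: E1 E2 Hy Hy' => -> -> [-> ->]; rewrite !mem_iota /= => Hy Hy' /(congr1 size).
by rewrite !inj => ?; congr (_, _); lia.
Qed.

Lemma card_parabolic i : #|par i| = 24.
Proof.
case: (ord3P i) => ->; rewrite /parabolic /=.
- by rewrite setUC (@card_dihedral ty2 ty1) //; vm_compute.
- by rewrite setUC (@card_dihedral ty2 ty0) //; vm_compute.
by rewrite (@card_dihedral ty0 ty1) //; vm_compute.
Qed.

(* By [factor_check_true], the four elements are the only ones compatible with the *)
(* action on the ball.                                                         *)
Lemma parabolic_factor_list a b : a \in par ty1 -> b \in par ty2 -> a * b \in par ty0 ->
  a * b \in [:: 1; rho ty2; rho ty2 * rho ty1; rho ty1].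
Proof.
(* Passing to [a^-1] turns [z = a * b] into [a^-1 * z = b], the form tested by [factor_check]. *)
rewrite /parabolic /= -groupV => Ha Hb; set z := a * b => Hz.
rewrite setUC in Ha; rewrite setUC in Hz.
have [wa Wa Ea] := @mem_dihedral ty2 ty0 _ isT Ha.
have [wb Wb Eb] := @mem_dihedral ty0 ty1 _ isT Hb.
have [wz Wz Ez] := @mem_dihedral ty2 ty1 _ isT Hz.
have C : compat (ball_table wa) (ball_table wz) (ball_table wb).
  by apply: compat_word; rewrite -Ea -Eb -Ez mulKg.
have T c d w : w \in dihedral_words c d ->
    (w, ball_table w) \in [seq (w, ball_table w) | w <- dihedral_words c d].
  by move=> Ww; apply/mapP; exists w.
have := factor_check_true.
move=> /allP/(_ _ (T _ _ _ Wz))/allP/(_ _ (T _ _ _ Wa))/allP/(_ _ (T _ _ _ Wb)).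
rewrite [compat _ _ _]C /= Ez => {Wz Ez Hz}; rewrite !inE => /or4P[] /eqP->.
- by rewrite /word big_nil eqxx.
- by rewrite /word big_seq1 eqxx orbT.
- by rewrite /word !big_cons big_nil mulg1 eqxx !orbT.
(* The last word is [rho ty1] in its normal form, because the twelfth power of the rotation is 1. *)
have E : rword (rcons (flatten (nseq 11 [:: ty2; ty1])) ty2) * rho ty1 = 1.
  rewrite -cats1 word_cat word_nseq /word !big_cons !big_nil !mulg1 -mulgA -expgSr.
  exact: rho_pow12.
have -> : rword (rcons (flatten (nseq 11 [:: ty2; ty1])) ty2) = rho ty1.
  by apply: (mulIg (rho ty1)); rewrite E rhoK.
by rewrite eqxx !orbT.
Qed.

Lemma rho_notin_par i : rho i \notin par i.
Proof.
have N1 : rho ty1 \notin par ty1.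
  rewrite /parabolic /= setUC; apply/negP=> /(@mem_dihedral ty2 ty0 _ isT)[w Ww].
  have -> : rho ty1 = rword [:: ty1] by rewrite /word big_seq1.
  move/esym/agree_word; apply/negP; move: w Ww; apply/allP; vm_compute; reflexivity.
have N2 : rho ty2 \notin par ty2.
  by rewrite -(ordS_ty.1.2) -rho_tau mem_parabolic_tau.
have N0 : rho ty0 \notin par ty0.
  by rewrite -[in X in rho X](ordS_ty.2) -rho_tau -ordS_ty.2 mem_parabolic_tau.
by case: (ord3P i) => ->.
Qed.

(** For [i = ty2] this is [parabolic_factor_list] with second factor 1: two of its four elements
    would put [rho ty1] into its own parabolic. The rotation [tau] gives the other types. *)
Lemma parabolicI_list i x : (forall j, j != i -> x \in par j) -> x = 1 \/ x = rho i.
Proof.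
have cap2 y : (forall j, j != ty2 -> y \in par j) -> y = 1 \/ y = rho ty2.
  move=> Hy; have Y0 := Hy ty0 isT; have Y1 := Hy ty1 isT.
  have := @parabolic_factor_list y 1 Y1 (group1 _); rewrite mulg1 => /(_ Y0).
  have nr1 := rho_notin_par ty1.
  rewrite !inE => /or4P[] /eqP E; [by left | by right | |];
    case/negP: nr1; last by rewrite -E.
  by rewrite -(groupMl _ (rho_parabolic (isT : ty2 != ty1))) -E.
have next j : (forall y, (forall l, l != j -> y \in par l) -> y = 1 \/ y = rho j) ->
    forall y, (forall l, l != ordS j -> y \in par l) -> y = 1 \/ y = rho (ordS j).
  move=> IH y Hy; have [|E|E] := IH (y ^ tau^-1).
  - move=> l ne_lj; rewrite -mem_parabolic_tau conjgKV Hy //.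
    by apply: contra ne_lj => /eqP/(can_inj (@ordSK _))->.
  - by left; rewrite -(conjgKV tau y) E conj1g.
  by right; rewrite -(conjgKV tau y) E rho_tau.
have := next _ (next _ cap2); have := next _ cap2; rewrite !ordS_ty => cap0 cap1.
by case: (ord3P i) x => ->.
Qed.

(** By the size of [J]: sizes 0 and 1 are the definitions, size 2 is [parabolicI_list], and for size
    3 [rho_notin_par] excludes the remaining involution. *)
Lemma bigcap_parabolic (J : {set 'I_3}) :
  GG k :&: \bigcap_(j in J) par j = <<[set rho i | i in ~: J]>>.
Proof.
apply/eqP; rewrite eqEsubset; apply/andP; split; last first.
  rewrite gen_subG; apply/subsetP=> _ /imsetP[i J'i ->]; rewrite inE rho_GG /=.
  apply/bigcapP=> j Jj; apply: rho_parabolic.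
  by apply: contraTneq J'i => ->; rewrite inE Jj.
apply/subsetP=> x /setIP[Gx /bigcapP Jx].
have : #|J| <= 3 by have := max_card (mem J); rewrite card_ord.
case Jn: #|J| => [|[|[|[|//]]]] _.
- by move/eqP: Jn Jx; rewrite cards_eq0 => /eqP-> _; rewrite setC0 -GGE.
- move/eqP: Jn Jx => /cards1P[j ->] Jx; rewrite -parabolicE.
  by apply: Jx; rewrite set11.
- have /cards1P[i Ji] : #|~: J| == 1%N by rewrite cardsCs setCK Jn card_ord.
  rewrite Ji imset_set1.
  have [|->|->] := @parabolicI_list i x; last by rewrite mem_gen ?set11.
    by move=> j; rewrite -in_set1 -Ji inE negbK; apply: Jx.
  exact: group1.
have J1 : J = setT by apply/eqP; rewrite eqEcard subsetT cardsT card_ord Jn.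
rewrite J1 in Jx.
have [j _|->|E] := @parabolicI_list ty0 x; first by rewrite Jx.
  exact: group1.
by case/negP: (rho_notin_par ty0); rewrite -E Jx.
Qed.

Lemma parabolic_factor a b : a \in par ty1 -> b \in par ty2 -> a * b \in par ty0 ->
  exists2 u, u \in par ty0 :&: par ty1 & u^-1 * (a * b) \in par ty2.
Proof.
move=> Ha Hb Hz; have := parabolic_factor_list Ha Hb Hz; move: (a * b) => z.
have R12 := rho_parabolic (isT : ty1 != ty2).
have R2 : rho ty2 \in par ty0 :&: par ty1 by rewrite inE !rho_parabolic.
rewrite !inE => /or4P[] /eqP->.
- by exists 1; rewrite ?group1 // mulg1 groupV group1.
- by exists (rho ty2); rewrite // mulVg group1.
- by exists (rho ty2); rewrite // mulKg.
by exists 1; rewrite ?group1 // invg1 mul1g.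
Qed.

Lemma rho_neq1 i : rho i != 1.
Proof. by apply: contraNneq (rho_notin_par i) => ->; rewrite group1. Qed.

(** * Triality and duality *)

Lemma lcoset_tau_subproof (u : Gamma k) :
  (ordS (val u).1, (val u).2 :^ tau).2
    \in lcosets (par (ordS (val u).1, (val u).2 :^ tau).1) (GG k).
Proof.
have /lcosetsP[x Gx ->] := valP u; apply/lcosetsP; exists (x ^ tau).
  by rewrite memJ_GG_tau.
by rewrite /= conjsMg conjg_set1 parabolic_tau.
Qed.

Definition conj_tau (u : Gamma k) : Gamma k :=
  Sub (ordS (val u).1, (val u).2 :^ tau) (lcoset_tau_subproof u).

Lemma conj_tau_inj : injective conj_tau.
Proof.
move=> u v /(congr1 val) E; apply: val_inj.
have E1 : (val u).1 = (val v).1 := can_inj (@ordSK _) (congr1 fst E).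
have E2 : (val u).2 = (val v).2 := @conjsg_inj _ tau _ _ (congr1 snd E).
by rewrite [LHS]surjective_pairing E1 E2 -surjective_pairing.
Qed.

Lemma conj_tau_coset i g : g \in GG k ->
  conj_tau (coset_in i g) = coset_in (ordS i) (g ^ tau).
Proof.
move=> Gg; apply: val_inj; rewrite val_coset_in ?memJ_GG_tau //=.
by rewrite Gg conjsMg conjg_set1 parabolic_tau.
Qed.

Lemma conj_tau_triality : is_triality (perm conj_tau_inj).
Proof.
have incP := @incP _ _ _ _ parabolic_sub.
split.
  apply/andP; split; apply/forallP=> u; apply/forallP=> v; rewrite !permE.
    apply/eqP; apply/idP/idP => [/incP|/incP] [g Gg [Eu Ev]]; apply/incP.
      exists (g ^ tau); rewrite ?memJ_GG_tau //.
      by split; rewrite [in LHS](Eu, Ev) conj_tau_coset.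
    exists (g ^ tau^-1); first by rewrite -memJ_GG_tau conjgKV.
    have Gg' : g ^ tau^-1 \in GG k by rewrite -memJ_GG_tau conjgKV.
    by split; apply: conj_tau_inj; rewrite conj_tau_coset // conjgKV.
  by apply/implyP=> /eqP tuv; apply/eqP; congr ordS.
exists (perm (can_inj (@ordSK 3))), ty0, ty1, ty2; split=> //.
- by move=> u; rewrite !permE.
- by apply/subsetP=> i _; case: (ord3P i) => ->; rewrite !inE eqxx ?orbT.
by split; rewrite permE ordS_ty.
Qed.

Lemma Gamma_flag_common (F : {set Gamma k}) : is_flag F ->
  exists2 g, g \in GG k & {in F, forall u, u = coset_in (typ u) g}.
Proof. exact: flag_common_rank3 parabolic_sub parabolic_factor F. Qed.

(** A duality would turn the relation [chiral_word] into another relation. For each of the three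
    transpositions of types the image word moves some point of the ball. *)
Lemma no_duality (phi : {perm Gamma k}) : ~ is_duality phi.
Proof.
case=> cor [i [j [ne_ij typE]]].
have := correlation_relation parabolic_sub Gamma_flag_common rhoK
  rho_neq1 bigcap_parabolic cor typE word_chiral.
have -> : 1 = rword [::] by rewrite /word big_nil.
move/agree_word; apply/negP.
(* The transposition as a plain function, so that the image word can be computed. *)
have E : tperm i j =1 fun x => if x == i then j else if x == j then i else x.
  by move=> x; rewrite permE /= .
rewrite (eq_map E).
by case: (ord3P i) (ord3P j) ne_ij => -> [] -> // _; vm_compute.
Qed.

End Family.

Theorem theorem5p1 :
  (forall k : nat,
    [/\ [/\ is_geometry (Gamma k), is_thin (Gamma k),
            flag_transitive (Gamma k) & residually_connected (Gamma k)],
        [/\ ~~ odd k -> automorphism_group (Gamma k) \isog 'Alt_('I_(13 + 9 * k)),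
            odd k -> automorphism_group (Gamma k) \isog 'Sym_('I_(13 + 9 * k))
          & [faithful GG k, on [set: Gamma k] | left_mul_action (GG k) (@parabolic k)]]
      & (exists phi : {perm Gamma k}, is_triality phi) /\
        ~ (exists phi : {perm Gamma k}, is_duality phi)]) /\
  (forall (i : 'I_3) (k k' : nat), #|parabolic k i| = #|parabolic k' i|).
Proof.
split=> [k|i k k']; last by rewrite !card_parabolic.
have sub := @parabolic_sub k; have FC := @Gamma_flag_common k.
have cap := @bigcap_parabolic k.
have iso := automorphism_group_isog sub FC (@rhoK k) (@rho_neq1 k) cap.
split; first split.
- exact: coset_geometry_geometry sub FC.
- exact: coset_geometry_thin sub FC _ (@rhoK k) (@rho_neq1 k) cap.
- exact: coset_geometry_flag_transitive sub FC.
- exact: coset_geometry_residually_connected sub FC _ cap.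
- split=> [evk|odk|]; first by rewrite -GG_even.
    by rewrite -GG_odd.
  exact: left_mul_faithful cap.
split; first by exists (perm (@conj_tau_inj k)); apply: conj_tau_triality.
by case=> phi /no_duality.
Qed.
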